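(* For every $m\ge0$ there exists a finite simple skew brace $B_m$ such that $(B_m,+)\cong\mathrm{PSU}_3(8)^{3^m}$, while $(B_m,\circ)$ is solvable.
   Context: A skew brace is a triple $(B,+,\circ)$ such that $(B,+)$ and $(B,\circ)$ are groups (neither assumed abelian) on the same set and $a\circ(b+c)=a\circ b-a+a\circ c$ for all $a,b,c\in B$. The two identity elements coincide and are denoted $0$. Its lambda map is $\lambda^B:(B,\circ)\to\mathrm{Aut}(B,+)$, $\lambda^B_a(b)=-a+a\circ b$. An ideal is a subgroup $I\le(B,+)$ with $I\trianglelefteq(B,+)$, $I\trianglelefteq(B,\circ)$ and $\lambda^B_a(I)=I$ for all $a\in B$. A non-zero skew brace is simple if its only ideals are $0$ and $B$. $\mathrm{PSU}_3(8)$ is the projective special unitary group of degree $3$ defined over the field extension $\mathbb{F}_{64}/\mathbb{F}_8$, a finite non-abelian simple group. *)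

(* Defs.v *)
From HB Require Import structures.
From mathcomp Require Import all_boot all_order all_algebra all_fingroup.
From mathcomp Require Import all_solvable all_field.

Set Implicit Arguments.
Unset Strict Implicit.
Unset Printing Implicit Defensive.

Import GRing.Theory.

Local Open Scope group_scope.

(* The additive group (B, +) of a finite skew brace is the underlying         *)
(* finGroupType. It need not be abelian, so it is written in MathComp's       *)
(* multiplicative notation: b * c, a^-1 and 1 below are b + c, -a and 0.      *)
Record finSkewBrace := FinSkewBrace {
  skew_add :> finGroupType;
  circ : skew_add -> skew_add -> skew_add;
  circ_one : skew_add;
  circ_inv : skew_add -> skew_add;
  circA : associative circ;
  circ1g : left_id circ_one circ;
  circVg : left_inverse circ_one circ_inv circ;
  circ_brace : forall a b c, circ a (b * c) = circ a b * a^-1 * circ a c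
}.

(* The multiplicative group (B, o), on an alias of the same carrier. *)
Definition circ_group (B : finSkewBrace) : Type := B.
HB.instance Definition _ (B : finSkewBrace) := Finite.on (circ_group B).
HB.instance Definition _ (B : finSkewBrace) :=
  Finite_isGroup.Build (circ_group B) (@circA B) (@circ1g B) (@circVg B).

Lemma circ_oneE (B : finSkewBrace) : circ_one B = 1.
Proof.
have := circ_brace (circ_one B) 1 1; rewrite !mulg1 !circ1g mulg1 mul1g.
by move/esym/eqP; rewrite eq_invg1 => /eqP.
Qed.

Definition lambda (B : finSkewBrace) (a b : B) : B := a^-1 * circ a b.

(* [A <| G] does not assert that A is a group, whence both group_set clauses. *)
Definition skew_ideal (B : finSkewBrace) (I : {set B}) : Prop :=
  let Ic : {set circ_group B} := I in
  [/\ group_set I, I <| [set: B],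
      group_set Ic, Ic <| [set: circ_group B]
    & forall a : B, lambda a @: I = I].

Definition simple_skew_brace (B : finSkewBrace) : Prop :=
  [set: B] != [set 1] /\
  forall I : {set B}, skew_ideal I -> I = [set 1] \/ I = [set: B].

Section Unitary.

Variables (n : nat) (F : finFieldType) (s : {rmorphism F -> F}).

(* For s an involution, the matrices of determinant 1 preserving the standard *)
(* nondegenerate s-Hermitian form.                                            *)
Definition SU : {set {'GL_n[F]}} :=
  [set g : {'GL_n[F]} |
    ((map_mx s (val g))^T *m val g == 1%:M)%R && (\det (val g) == 1)%R].

Lemma SU_group_set : group_set SU.
Proof.
apply/group_setP; split=> [|g h].
  by rewrite inE /= map_mx1 trmx1 mulmx1 det1 !eqxx.
rewrite !inE => /andP[/eqP Ug /eqP dg] /andP[/eqP Uh /eqP dh].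
have -> : val (g * h)%g = (val g *m val h)%R by [].
rewrite map_mxM trmx_mul mulmxA -(mulmxA _ _ (val g)) Ug mulmx1 Uh.
by rewrite det_mulmx dg dh mulr1 !eqxx.
Qed.

Canonical SU_group := Group SU_group_set.

Definition PSU := SU / 'Z(SU).

End Unitary.

Definition F64 : finFieldType :=
  s2val (@pPrimePowerField 2 6 isT isT).

Lemma pchar_F64 : (2 \in [pchar F64])%R.
Proof. exact: s2valP (@pPrimePowerField 2 6 isT isT). Qed.

Lemma card_F64 : #|F64| = 64.
Proof. exact: s2valP' (@pPrimePowerField 2 6 isT isT). Qed.

(* The involution of F64 with fixed field F_8. *)
Definition frob8 (x : F64) : F64 := (x ^+ 8)%R.

Lemma frob8_is_zmod_morphism : zmod_morphism frob8.
Proof.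
move=> x y; rewrite /frob8 exprDn_pchar; last first.
  by rewrite (eq_pnat _ (pcharf_eq pchar_F64)).
by rewrite exprNn -signr_odd /= mul1r (oppr_pchar2 pchar_F64).
Qed.

Lemma frob8_is_monoid_morphism : monoid_morphism frob8.
Proof. by split=> [|x y]; rewrite /frob8 ?expr1n ?exprMn. Qed.

HB.instance Definition _ :=
  GRing.isZmodMorphism.Build F64 F64 frob8 frob8_is_zmod_morphism.
HB.instance Definition _ :=
  GRing.isMonoidMorphism.Build F64 F64 frob8 frob8_is_monoid_morphism.

Definition PSU_3_8 := PSU 3 frob8.

(* The external direct power G ^ k. *)
Definition direct_power (gT : finGroupType) (G : {set gT}) (k : nat) :
    {set {dffun 'I_k -> gT}} :=
  setXn (fun _ : 'I_k => G).

(* Main.v *)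
(* Let N = PSU_3(8). If subgroups A and P of some group normalize N, meet     *)
(* trivially and satisfy N <= A P, then every n in N is uniquely d r with d   *)
(* in A and r in P, and n o m = d m r turns N into a skew brace whose         *)
(* multiplicative group embeds in A x P (up to inversion in P). Here A is the *)
(* group of the semilinear maps x |-> t x^(4^k), with t^3591 = 1, of          *)
(* K = F_(2^18), viewed as a hermitian 3-space over F_64 with the form        *)
(* Tr(x y^512), and P is the stabilizer of an isotropic vector in the group   *)
(* generated by A and SU_3(8); both are taken modulo scalars. A acts          *)
(* regularly on the nonzero isotropic vectors: an isotropic x gives           *)
(* z = x^3591 with z^9 + z + 1 = 0 and z of order 73, so there are at most    *)
(* 9 * 3591 isotropic vectors, and z is fixed by no map z |-> z^(4^k) with    *)
(* 0 < k < 9. A and P are solvable, and k mod 3 is a surjective homomorphism  *)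
(* chi from the multiplicative group to Z/3.                                  *)
(*   Given a skew brace B with such a chi, q o r := q o sigma^s(q)(r), with   *)
(* sigma the cyclic shift of B^3 and s(q) the sum of the chi(q_i), is a skew  *)
(* brace on B^3, and s is again such a homomorphism. Since lambda now         *)
(* permutes the three factors transitively, the absence of proper             *)
(* lambda-invariant normal subgroups is inherited, and m steps give           *)
(* N^(3^m).                                                                   *)

Require Import Defs.
From HB Require Import structures.
From mathcomp Require Import all_boot all_order all_algebra all_fingroup.
From mathcomp Require Import all_solvable all_field.
From mathcomp Require Import ring.

Set Implicit Arguments.
Unset Strict Implicit.
Unset Printing Implicit Defensive.

Import GRing.Theory.

Local Open Scope group_scope.

(** For m = 0 the brace comes from a factorization. On the hermitian 3-space K, the solvable group
    [singer] acts regularly on the nonzero isotropic vectors: it acts freely ([semiact_inj]), and a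
    polynomial bound on the number of such vectors ([card_iso_le]) makes it transitive
    ([semiact_trans]). Hence it meets the stabilizer [point_stab] trivially and their product
    contains the image of SU_3(8) ([linear_part_sub_factor]). Modulo scalars, [factorization_brace]
    applies, and [solvable_factorization_brace] gives solvability.

    Simplicity of PSU_3(8) is an Iwasawa-type argument. SU_3(8) is doubly transitive on isotropic
    lines, so a noncentral normal subgroup H is transitive on them and G = [line_stab] H. As
    [line_stab] is solvable and lies in the derived subgroup, G is perfect ([SU_perfect]) and G / H,
    a solvable perfect group, is trivial ([SU_normal]).

    The step from B to B^3 is [wreath_brace]. Trivial centre puts a nontrivial part of one factor in
    each nontrivial normal subgroup, and the shift built into lambda spreads it to all factors
    ([lambda_simple_wreath]). The induction is [simple_brace_powers]. *)

(** * Solvability and commutator preliminaries *)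

Lemma solvable_ker_im (aT rT : finGroupType) (G : {group aT})
    (f : {morphism G >-> rT}) :
  solvable ('ker f) -> solvable (f @* G) -> solvable G.
Proof.
move=> solK solI; rewrite (series_sol (ker_normal f)) solK.
by rewrite (isog_sol (first_isog f)).
Qed.

Lemma solvable_quotient_normal (gT : finGroupType) (G N P : {group gT}) :
    N <| G -> P \subset G -> solvable (G / N) -> solvable (N :&: P) ->
  solvable P.
Proof.
move=> nNG sPG solGN solPN.
have nNP : P \subset 'N(N) := subset_trans sPG (normal_norm nNG).
have nsI : N :&: P <| P by rewrite /normal subsetIr normsI ?normG.
rewrite (series_sol nsI) solPN (isog_sol (second_isog nNP)).
exact: solvableS (quotientS N sPG) solGN.
Qed.

(** Since [t] centralizes no nontrivial element of [U], the map v |-> [v, t] is injective on [U],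
    hence onto by finiteness. *)
Lemma commg_surj (gT : finGroupType) (U : {group gT}) t u :
    t \in 'N(U) -> (forall v, v \in U -> commute v t -> v = 1) ->
  u \in U -> exists2 v, v \in U & u = [~ v, t].
Proof.
move=> nUt CU1 Uu; pose f v := [~ v, t].
have sfU : f @: U \subset U.
  apply/subsetP=> _ /imsetP[v Uv ->].
  by rewrite /f commgEl groupM ?groupV // memJ_norm.
have f_inj : {in U &, injective f}.
  move=> v w Uv Uw; rewrite /f !commgEl => eq_vw.
  have vt : (v ^ t = v * (w^-1 * w ^ t)) by rewrite -eq_vw mulKVg.
  have wv : commute (w * v^-1) t.
    apply/commgP/conjg_fixP; rewrite conjMg conjVg vt !invMg invgK.
    by rewrite -!mulgA !mulKVg mulKg invgK.
  have := CU1 _ _ wv; rewrite groupM ?groupV // => /(_ isT)/eqP.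
  by rewrite -eq_mulgV1 => /eqP.
have : u \in f @: U.
  suffices -> : f @: U = U by [].
  by apply/eqP; rewrite eqEcard sfU card_in_imset /=.
by case/imsetP=> v Uv ->; exists v.
Qed.

(** * Skew braces from factorizations *)

(* Each [n] in [N] is [d * r] with [d] in [A] and [r] in [P]; below         *)
(* [fcirc n m = d * m * r], which is [n * m ^ r] and hence lies in [N].      *)
Section FactorizationBrace.

Variables (gT : finGroupType) (N A P : {group gT}).
Hypotheses (nNA : A \subset 'N(N)) (nNP : P \subset 'N(N)).
Hypotheses (tiAP : A :&: P = 1) (sNAP : N \subset A * P).

Let r (x : subg_of N) : gT := remgr A P (sgval x).
Let d (x : subg_of N) : gT := divgr A P (sgval x).

Let rP x : r x \in P.
Proof. by rewrite mem_remgr ?(subsetP sNAP) ?subgP. Qed.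

Let dA x : d x \in A.
Proof. by rewrite mem_divgr ?(subsetP sNAP) ?subgP. Qed.

Let drE x : sgval x = d x * r x. Proof. exact: divgr_eq. Qed.

Definition fcirc (x y : subg_of N) : subg_of N :=
  subg N (sgval x * sgval y ^ remgr A P (sgval x)).

(** For x = d r this is d^-1 r^-1, written as the conjugate of x^-1 by d to show that it lies in
    [N]. *)
Definition fcirc_inv (x : subg_of N) : subg_of N :=
  subg N ((sgval x)^-1 ^ divgr A P (sgval x)).

Let fcircK x y : sgval (fcirc x y) = sgval x * sgval y ^ r x.
Proof.
by rewrite subgK // groupM ?subgP // memJ_norm ?subgP // (subsetP nNP) ?rP.
Qed.

Let fcircE x y : sgval (fcirc x y) = (d x * d y) * (r y * r x).
Proof. by rewrite fcircK {1}(drE x) (drE y) conjgE -!mulgA mulKVg. Qed.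

Lemma remgr_fcirc x y :
  remgr A P (sgval (fcirc x y)) =
    remgr A P (sgval y) * remgr A P (sgval x).
Proof.
rewrite fcircE (remgrMid tiAP) ?(groupM (rP y) (rP x)) //.
by rewrite groupM ?dA.
Qed.

Let d_fcirc x y : d (fcirc x y) = d x * d y.
Proof.
rewrite /d fcircE (divgrMid tiAP) ?(groupM (rP y) (rP x)) //.
by rewrite groupM ?dA.
Qed.

Let r_fcirc x y : r (fcirc x y) = r y * r x.
Proof. exact: remgr_fcirc. Qed.

Lemma fcircA : associative fcirc.
Proof.
move=> x y z; apply: val_inj; rewrite /= fcircE d_fcirc r_fcirc.
by rewrite fcircE d_fcirc r_fcirc !mulgA.
Qed.

Lemma fcirc1g : left_id 1 fcirc.
Proof.
move=> x; apply: val_inj; rewrite /= fcircK /r /= remgr1 ?group1 //.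
by rewrite conjg1 mul1g.
Qed.

Lemma fcircVg : left_inverse 1 fcirc_inv fcirc.
Proof.
move=> x; apply: val_inj; rewrite /= fcircE.
have dvN : sgval (fcirc_inv x) = (d x)^-1 * (r x)^-1.
  rewrite subgK; last by rewrite memJ_norm ?groupV ?subgP // (subsetP nNA) ?dA.
  rewrite -/(d x) conjVg conjgE.
  have -> : (d x)^-1 * (sgval x * d x) = r x * d x.
    by rewrite mulgA; congr (_ * _); apply: (canLR (mulKg _)); exact: drE.
  by rewrite invMg.
have -> : d (fcirc_inv x) = (d x)^-1.
  by rewrite /d dvN (divgrMid tiAP) ?groupV ?rP ?dA.
have -> : r (fcirc_inv x) = (r x)^-1.
  by rewrite /r dvN (remgrMid tiAP) ?groupV ?rP ?dA.
by rewrite mulVg mulgV mulg1.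
Qed.

Lemma fcirc_brace (a b c : subg_of N) :
  fcirc a (b * c) = fcirc a b * a^-1 * fcirc a c.
Proof.
have sgM u v : sgval (u * v : subg_of N) = sgval u * sgval v by [].
have sgV u : sgval (u^-1 : subg_of N) = (sgval u)^-1 by [].
apply: val_inj; rewrite [\val]/= fcircK !sgM sgV !fcircK.
by rewrite conjMg -!mulgA mulKg.
Qed.

Definition factorization_brace : finSkewBrace :=
  @FinSkewBrace (subg_of N) fcirc 1 fcirc_inv fcircA fcirc1g fcircVg
    fcirc_brace.

(** The maps x |-> d x and x |-> (r x)^-1 are homomorphisms to [A] and [P], the inversion
    compensating for [r] reversing products. They are jointly injective because x = d r. *)
Lemma solvable_factorization_brace :
  solvable A -> solvable P -> solvable [set: circ_group factorization_brace].
Proof.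
move=> solA solP; pose Bc := circ_group factorization_brace.
have rM : {in [set: Bc] &, {morph (fun x : Bc => (r x)^-1) : x y / x * y}}.
  by move=> x y _ _; rewrite -invMg -r_fcirc.
have dM : {in [set: Bc] &, {morph (fun x : Bc => d x) : x y / x * y}}.
  by move=> x y _ _; rewrite -d_fcirc.
pose fr := Morphism rM; pose fd := Morphism dM.
apply: (@solvable_ker_im _ _ _ fr); last first.
  apply: solvableS solP; apply/subsetP=> _ /morphimP[x _ _ ->].
  by rewrite groupV rP.
have sK : 'ker fr \subset [set: Bc] := subsetT _.
apply: (@solvable_ker_im _ _ _ [morphism of restrm sK fd]).
  apply: (solvableS _ (solvable1 _)); apply/subsetP=> x kx.
  have dx : d x = 1 := mker kx.
  have rx : (r x)^-1 = 1 := mker (dom_ker kx).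
  rewrite inE; apply/eqP/val_inj; rewrite [\val]/=; apply: etrans (drE x) _.
  by rewrite dx mul1g; apply: (can_inj invgK); rewrite rx invg1.
apply: solvableS solA; apply/subsetP=> _ /morphimP[x _ _ ->].
by rewrite /= /restrm dA.
Qed.

End FactorizationBrace.

(* Stronger than simplicity, since [I] is not required to be normal in the *)
(* multiplicative group: this is what makes it pass to [wreath_brace].     *)
Definition lambda_simple (B : finSkewBrace) :=
  forall I : {group B}, I <| [set: B] ->
    (forall a x, x \in I -> lambda a x \in I) -> I :=: 1 \/ I :=: [set: B].

Lemma lambda_simple_brace (B : finSkewBrace) :
  [set: B] != 1 -> lambda_simple B -> simple_skew_brace B.
Proof.
move=> nt simB; split=> // I [gI nI _ _ lI].
have lI' a x : x \in Group gI -> lambda a x \in Group gI.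
  by move=> Ix; have := imset_f (lambda a) Ix; rewrite (lI a).
have [|] := simB (Group gI) nI lI'.
by left.
by right.
Qed.

(** * The shifted skew brace on B^3 *)

Section CyclicWreath.

Variables (B : finSkewBrace) (chi : B -> 'I_3).
Hypothesis chiM : forall a b : B, chi (circ a b) = (chi a + chi b)%R.

Notation W := {dffun forall _ : 'I_3, skew_add B}.

Definition wsum (x : W) : 'I_3 := (\sum_i chi (x i))%R.

Definition wcirc (x y : W) : W := [ffun i => circ (x i) (y (i + wsum x)%R)].

Definition wone : W := [ffun=> circ_one B].

Definition wcirc_inv (x : W) : W := [ffun i => circ_inv (x (i - wsum x)%R)].

Lemma chi_one : chi (circ_one B) = 0%R.
Proof. by apply: (addrI (chi (circ_one B))); rewrite -chiM circ1g addr0. Qed.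

Lemma chi_inv a : chi (circ_inv a) = (- chi a)%R.
Proof. by apply: (addIr (chi a)); rewrite -chiM circVg chi_one addNr. Qed.

Lemma sum_shift (f : 'I_3 -> 'I_3) k : (\sum_i f (i + k) = \sum_i f i)%R.
Proof. by rewrite [RHS](reindex_inj (addIr k)). Qed.

(** A sum over all coordinates does not see the cyclic shift. This additivity is what makes [wcirc]
    associative. *)
Lemma wsum_circ x y : wsum (wcirc x y) = (wsum x + wsum y)%R.
Proof.
rewrite /wsum (eq_bigr (fun i => chi (x i) + chi (y (i + wsum x)))%R).
  by rewrite big_split (sum_shift (fun i => chi (y i))).
by move=> i _; rewrite ffunE chiM.
Qed.

Lemma wcircA : associative wcirc.
Proof.
move=> x y z; apply/ffunP=> i.
by rewrite ffunE ffunE [RHS]ffunE ffunE wsum_circ addrA circA.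
Qed.

Lemma wsum_one : wsum wone = 0%R.
Proof. by rewrite /wsum big1 // => i _; rewrite ffunE chi_one. Qed.

Lemma wcirc1g : left_id wone wcirc.
Proof.
by move=> x; apply/ffunP=> i; rewrite ffunE wsum_one ffunE circ1g addr0.
Qed.

Lemma wsum_inv x : wsum (wcirc_inv x) = (- wsum x)%R.
Proof.
rewrite /wsum (eq_bigr (fun i => - chi (x (i - wsum x)))%R).
  by rewrite sumrN (sum_shift (fun i => chi (x i))).
by move=> i _; rewrite ffunE chi_inv.
Qed.

Lemma wcircVg : left_inverse wone wcirc_inv wcirc.
Proof.
by move=> x; apply/ffunP=> i; rewrite ffunE wsum_inv ffunE circVg ffunE.
Qed.

Lemma wcirc_brace (a b c : W) :
  wcirc a (b * c) = wcirc a b * a^-1 * wcirc a c.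
Proof. by apply/ffunP=> i; rewrite !ffunE circ_brace. Qed.

Definition wreath_brace : finSkewBrace :=
  @FinSkewBrace W wcirc wone wcirc_inv wcircA wcirc1g wcircVg wcirc_brace.

Lemma lambda_wreathE (a x : wreath_brace) i :
  (lambda a x : W) i = lambda ((a : W) i) ((x : W) (i + wsum a)%R).
Proof. by rewrite /lambda ffunE ffunE [X in _ * X]ffunE. Qed.

(** [wsum] maps to the abelian group Z/3, and on its kernel there is no shift, so the kernel embeds
    in the direct cube of the multiplicative group of [B]. *)
Lemma solvable_wreath :
  solvable [set: circ_group B] -> solvable [set: circ_group wreath_brace].
Proof.
move=> solB; pose Wc := circ_group wreath_brace.
have sM : {in [set: Wc] &,
    {morph (fun x : Wc => wsum x : 'I_3) : x y / x * y}}.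
  by move=> x y _ _; apply: wsum_circ.
pose fs := Morphism sM.
apply: (@solvable_ker_im _ _ _ fs); last first.
  by apply/abelian_sol/centsP=> x _ y _; apply: addrC.
pose T := {dffun forall _ : 'I_3, circ_group B}.
have tM : {in 'ker fs &, {morph (fun x : Wc => x : T) : x y / x * y}}.
  move=> x y kx _; have sx : wsum x = 0%R := mker kx.
  by apply/ffunP=> i; rewrite [RHS]ffunE /= [LHS]ffunE sx addr0.
apply: (@solvable_ker_im _ _ _ (Morphism tM)).
  apply: (solvableS _ (solvable1 _)); apply/subsetP=> x kx.
  by have xt : x = 1 := mker kx; rewrite inE; apply/eqP.
apply: solvableS (setXn_sol (fun _ => solB)).
by apply/subsetP=> x _; apply/setXnP=> i; rewrite inE.
Qed.

End CyclicWreath.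

Lemma lambda1 (B : finSkewBrace) (a : B) : lambda a 1 = 1.
Proof.
rewrite /lambda; have := circ_brace a 1 1; rewrite mulg1 => aE.
by apply: (mulgI (circ a 1)); rewrite mulg1 mulgA -aE.
Qed.

Lemma lambda_one (B : finSkewBrace) (b : B) : lambda (circ_one B) b = b.
Proof. by rewrite /lambda circ1g circ_oneE invg1 mul1g. Qed.

(** * Inheritance of lambda-simplicity *)

Section WreathSimple.

Variables (B : finSkewBrace) (chi : B -> 'I_3).
Hypothesis chiM : forall a b : B, chi (circ a b) = (chi a + chi b)%R.
Hypothesis chi_nt : exists a : B, chi a != 0%R.
Hypothesis Z1 : 'Z([set: B]) = 1.

Notation W := {dffun forall _ : 'I_3, skew_add B}.
Notation WB := (wreath_brace chiM).
Notation at_ i b := (@dfung1 'I_3 (fun=> skew_add B) i b).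

Lemma chi_surj k : exists a : B, chi a = k.
Proof.
have [a nz_a] := chi_nt.
have : [|| k == 0, k == chi a | k == chi a + chi a]%R.
  by move: nz_a; case: (chi a) k => [[|[|[|?]]] ?] [[|[|[|?]]] ?].
case/or3P=> /eqP->; first by exists (circ_one B); exact: chi_one.
  by exists a.
by exists (circ a a).
Qed.

Lemma dffun_prodE (x : W) : x = \prod_i at_ i (x i).
Proof.
apply/ffunP=> i; rewrite prodg_ffun.
rewrite (eq_bigr (fun t => if t == i then x t else 1)) => [|t _].
  by rewrite -big_mkcond big_pred1_eq.
by have [->|ti] := eqVneq t i; rewrite ?dfung1_id ?dfung1_dflt.
Qed.

(* [wsum] of this element, which steers the shift, can be adjusted by [c] *)
(* without changing the component [a] at [i].                             *)
Definition two_val (i : 'I_3) (a c : B) : W :=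
  [ffun j => if j == i then a else if j == (i + 1)%R then c else circ_one B].

Lemma wsum_two_val i a c : wsum chi (two_val i a c) = (chi a + chi c)%R.
Proof.
have ni : (i + 1 != i)%R by case: i => [[|[|[|?]]] ?].
rewrite /wsum (bigD1 i) //= (bigD1 (i + 1)%R) //= big1 ?addr0.
  by rewrite !ffunE eqxx (negPf ni) eqxx.
by move=> j /andP[/negPf ji /negPf ji1]; rewrite ffunE ji ji1 chi_one.
Qed.

Lemma lambda_two_val i j (a c b : B) : (i + (chi a + chi c) = j)%R ->
  lambda (two_val i a c : WB) (at_ j b) = at_ i (lambda a b).
Proof.
move=> ij; apply/ffunP=> k; rewrite lambda_wreathE wsum_two_val.
have [<-|ik] := eqVneq i k.
  by rewrite ij !dfung1_id ffunE eqxx.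
rewrite !dfung1_dflt ?lambda1 //.
by rewrite -ij (inj_eq (addIr _)).
Qed.

(** If x in [I] has a nontrivial entry at j, that entry is not central in [B], so a commutator of x
    with the factor j is a nontrivial element of [I] inside that factor. By lambda-simplicity of [B]
    the whole factor lies in [I], and lambda carries it onto the other factors. *)
Lemma lambda_simple_wreath : lambda_simple B -> lambda_simple WB.
Proof.
move=> simB I nI lI; have [->|ntI] := eqVneq I 1%G; [by left | right].
have [x Ix ntx] := trivgPn _ ntI.
have nIJ y z : y \in I -> y ^ z \in I.
  by move=> Iy; rewrite memJ_norm // (subsetP (normal_norm nI)) ?inE.
have [j ntxj] : exists j, (x : W) j != 1.
  apply/existsP; apply: contraR ntx => /existsPn x1; apply/eqP/ffunP=> j.
  by rewrite ffunE; apply/eqP; have := x1 j; rewrite negbK.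
(* The trace of [I] on the i-th factor, pulled back to [B]. *)
pose H i := [set b : B | at_ i b \in I].
have gH i : group_set (H i).
  apply/group_setP; split=> [|b c]; rewrite !inE ?(dfung1_morphM b c).
    have -> : at_ i 1 = 1 :> W.
      exact: (morph1 [morphism of @dfung1 'I_3 (fun=> skew_add B) i]).
    exact: group1.
  exact: groupM.
have nH i : Group (gH i) <| [set: B].
  rewrite /normal subsetT; apply/subsetP=> c _; rewrite inE.
  apply/subsetP=> _ /imsetP[b Hb ->]; rewrite inE.
  have -> : at_ i (b ^ c) = (at_ i b : W) ^ at_ i c.
    exact: (morphJ [morphism of @dfung1 'I_3 (fun=> skew_add B) i]).
  by apply: nIJ; rewrite inE in Hb.
have lHI i k a b : at_ i b \in I -> at_ k (lambda a b) \in I.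
  move=> Ib; have [c chi_c] := chi_surj (i - k - chi a)%R.
  rewrite -(@lambda_two_val k i a c b); first exact: (lI (two_val k a c : WB)).
  by rewrite chi_c (addrC (chi a)) subrK (addrC k) subrK.
have Hj1 : Group (gH j) <> 1 :> {set B}.
  move=> Hj1; case/negP: ntxj.
  suffices: (x : W) j \in 'Z([set: B]) by rewrite Z1 inE.
  apply/centerP; split=> [|b _]; first by rewrite inE.
  apply/commgP; suffices: [~ (x : W) j, b] \in Group (gH j) by rewrite Hj1 inE.
  rewrite inE.
  have -> : at_ j [~ (x : W) j, b] = [~ x, at_ j b].
    apply/ffunP=> i; rewrite /commg /conjg !(mulg_ffun, invg_ffun).
    have [<-|ji] := eqVneq j i; first by rewrite !dfung1_id.
    by rewrite !dfung1_dflt // invg1 mul1g mulg1 mulVg.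
  by rewrite commgEl groupM ?groupV // nIJ.
have HjT : Group (gH j) = [set: B] :> {set B}.
  have lH a b : b \in Group (gH j) -> lambda a b \in Group (gH j).
    by rewrite !inE; apply: lHI.
  by case: (simB _ (nH j) lH).
have Iat i b : at_ i b \in I.
  rewrite -(lambda_one b); apply: (lHI j).
  have : b \in Group (gH j) by rewrite HjT inE.
  by rewrite inE.
apply/setP=> y; rewrite inE (dffun_prodE y).
by apply: group_prod => i _; apply: Iat.
Qed.

Lemma center_wreath : 'Z([set: WB]) = 1.
Proof.
apply/trivgP/subsetP=> x /centerP[_ cx]; rewrite inE; apply/eqP/ffunP=> i.
have Zxi : (x : W) i \in 'Z([set: B]).
  apply/centerP; split=> [|b _]; first by rewrite inE.
  have /ffunP/(_ i) := cx (at_ i b) (in_setT _).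
  by rewrite !mulg_ffun !dfung1_id.
by move: Zxi; rewrite Z1 inE => /eqP ->; rewrite ffunE.
Qed.

Lemma wsum_nt : exists x : WB, wsum chi x != 0%R.
Proof.
have [a nz_a] := chi_nt.
by exists (two_val 0%R a (circ_one B)); rewrite wsum_two_val chi_one // addr0.
Qed.

End WreathSimple.

(** * Direct powers and the induction on m *)

Section Powers.

Variables (gT : finGroupType) (G : {group gT}).

(* [f] identifies [(B, +)] with the group of functions from [J] to [G]. *)
Record power_repr (B : finSkewBrace) (J : finType) (f : B -> J -> gT) : Prop :=
  PowerRepr {
    power_reprM : forall x y j, f (x * y) j = f x j * f y j;
    power_repr_inj : forall x y, f x =1 f y -> x = y;
    power_repr_mem : forall x j, f x j \in G;
    power_repr_onto :
      forall g : J -> gT, (forall j, g j \in G) -> exists x, f x =1 g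
  }.

Lemma power_repr_isog (B : finSkewBrace) (J : finType) (f : B -> J -> gT) k :
  power_repr f -> #|J| = k -> [set: B] \isog direct_power G k.
Proof.
move=> [fM fI fG fS] <-.
pose h (x : B) : {dffun 'I_#|J| -> gT} := [ffun i => f x (enum_val i)].
have hM : {in [set: B] &, {morph h : x y / x * y}}.
  by move=> x y _ _; apply/ffunP=> i; rewrite mulg_ffun !ffunE fM.
apply/isogP; exists (Morphism hM).
  apply/injmP=> x y _ _ /ffunP hxy; apply: fI => j.
  by have := hxy (enum_rank j); rewrite !ffunE enum_rankK.
apply/setP=> y; apply/morphimP/setXnP => [[x _ _ ->] i | Gy].
  by rewrite ffunE.
have [x fx] := fS (fun j => y (enum_rank j)) (fun j => Gy _).
exists x; rewrite ?inE //; apply/ffunP=> i.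
by rewrite ffunE fx enum_valK.
Qed.

Lemma wreath_power_repr (B : finSkewBrace) (chi : B -> 'I_3)
    (chiM : forall a b : B, chi (circ a b) = (chi a + chi b)%R)
    (J : finType) (f : B -> J -> gT) :
  power_repr f ->
  @power_repr (wreath_brace chiM) ('I_3 * J)%type
    (fun x p => f ((x : {dffun forall _ : 'I_3, skew_add B}) p.1) p.2).
Proof.
move=> [fM fI fG fS]; split=> [x y [i j]|x y fxy|x [i j]|g Gg] /=.
- by rewrite mulg_ffun fM.
- by apply/ffunP=> i; apply: fI => j; apply: (fxy (i, j)).
- exact: fG.
have xP i : exists x, [forall j, f x j == g (i, j)].
  have [x fx] := fS _ (fun j => Gg (i, j)).
  by exists x; apply/forallP=> j; rewrite fx.
exists [ffun i => xchoose (xP i)] => -[i j] /=; rewrite ffunE.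
by apply/eqP; move: (xchooseP (xP i)) => /forallP.
Qed.

Lemma simple_brace_powers (B0 : finSkewBrace) (chi0 : B0 -> 'I_3)
    (f0 : B0 -> unit -> gT) :
    (forall a b : B0, chi0 (circ a b) = (chi0 a + chi0 b)%R) ->
    (exists a : B0, chi0 a != 0%R) -> 'Z([set: B0]) = 1 -> lambda_simple B0 ->
    solvable [set: circ_group B0] -> power_repr f0 ->
  forall m, exists B : finSkewBrace,
    [/\ simple_skew_brace B, [set: B] \isog direct_power G (3 ^ m)
      & solvable [set: circ_group B]].
Proof.
move=> chiM0 nt0 Z0 sim0 sol0 repr0 m.
(* The next power needs a nontrivial [chi], a trivial centre and lambda-simplicity, so the induction
   carries them along. The index type [J] stays abstract, to be enumerated only at the end. *)
suffices: exists (B : finSkewBrace) (chi : B -> 'I_3) (J : finType)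
    (f : B -> J -> gT),
    [/\ forall a b : B, chi (circ a b) = (chi a + chi b)%R,
        exists a : B, chi a != 0%R & 'Z([set: B]) = 1] /\
    [/\ lambda_simple B, solvable [set: circ_group B], power_repr f
      & #|J| = (3 ^ m)%N].
  case=> B [chi [J [f [[chiM [a nz_a] Z1] [simB solB reprB cardJ]]]]].
  exists B; split=> //; last exact: power_repr_isog reprB cardJ.
  apply: lambda_simple_brace simB; apply/trivgPn; exists a; rewrite ?inE //.
  by apply: contraNneq nz_a => ->; rewrite -circ_oneE chi_one.
elim: m => [|m [B [chi [J [f [[chiM nt Z1] [simB solB reprB cardJ]]]]]]].
  by exists B0, chi0, unit, f0; split; split=> //; rewrite card_unit.
exists (wreath_brace chiM), (wsum chi), ('I_3 * J)%type,
  (fun x p => f ((x : {dffun forall _ : 'I_3, skew_add B}) p.1) p.2).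
split; split.
- exact: wsum_circ.
- exact: wsum_nt.
- exact: center_wreath.
- exact: lambda_simple_wreath.
- exact: solvable_wreath.
- exact: (wreath_power_repr chiM reprB).
by rewrite card_prod card_ord cardJ expnS.
Qed.

End Powers.

Local Open Scope ring_scope.

(** * The regular semilinear group on isotropic vectors *)

Lemma expf_card1 (F : finFieldType) (x : F) : x != 0 -> x ^+ #|F|.-1 = 1.
Proof.
move=> nz_x; apply: (mulfI nz_x); rewrite -exprS prednK ?expf_card ?mulr1 //.
exact: ltnW (finNzRing_gt1 F).
Qed.

Lemma finField_prim_root (F : finFieldType) :
  exists g : F, #|F|.-1.-primitive_root g.
Proof.
have F1_gt0 : (0 < #|F|.-1)%N.
  by rewrite -ltnS prednK ?finNzRing_gt1 // ltnW ?finNzRing_gt1.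
have := @has_prim_root F _ (enum (predC1 (0 : F))) F1_gt0.
case/(_ _ (enum_uniq _) _)/hasP=> [||g _ g_prim]; last by exists g.
  apply/allP=> x; rewrite mem_enum /= => nz_x.
  by apply/unity_rootP; apply: expf_card1.
by rewrite -cardE cardC1.
Qed.

(** A cube root x of z in F_64 would satisfy x^27 = x^63 = 1, hence z^3 = x^9 = 1. So the cubic X^3
    - z has no root and is irreducible. *)
Lemma exists_cubic_kummer_ext (F : finFieldType) (z : F) :
    #|F| = 64%N -> z ^+ 9 = 1 -> z ^+ 3 != 1 ->
  exists (K : finFieldType) (iota : {rmorphism F -> K}) (w : K),
    #|K| = (2 ^ 18)%N /\ w ^+ 3 = iota z.
Proof.
move=> cardF z9 z3; pose p : {poly F} := 'X^3 - z%:P.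
have sp : size p = 4 by rewrite size_XnsubC.
have irr_p : irreducible_poly p.
  apply: cubic_irreducible => [|x]; first by rewrite sp.
  apply: contra z3; rewrite /root !hornerE subr_eq0 => /eqP zx.
  have nz_x : x != 0.
    apply: contraTneq isT => x0; move: z9; rewrite -zx x0 expr0n /= => /eqP.
    by rewrite expr0n eq_sym oner_eq0.
  have := expf_card1 nz_x; rewrite cardF /= => x63.
  have x27 : x ^+ 27 = 1 by rewrite (exprM x 3 9) zx.
  have: x ^+ (27 * 2 + 9) = 1 by [].
  by rewrite exprD exprM x27 expr1n mul1r -zx -exprM => ->.
have [L dimL [w rw _]] := irredp_FAdjoin irr_p.
pose K := FinFieldExtType L.
exists K, (GRing.in_alg L), w; split.
  have := card_vspacef (Vector.class (finvect_type L)).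
  rewrite (card_vspace (T := finvect_type L)).
  rewrite (dimL : \dim {: finvect_type L} = _) sp cardF => <-.
  by rewrite -(expnM 2 6 3).
apply/eqP; move: rw; rewrite rmorphB /= map_polyXn map_polyC /=.
by rewrite /root !hornerE subr_eq0.
Qed.

Lemma exprD_pow2 (K : finFieldType) (x y : K) n :
  2%N \in [pchar K] -> (x + y) ^+ (2 ^ n) = x ^+ (2 ^ n) + y ^+ (2 ^ n).
Proof.
move=> K2; rewrite exprDn_pchar // (eq_pnat _ (pcharf_eq K2)).
by rewrite pnatX pnat_id.
Qed.

Lemma pow4_mod73_inj (k l : 'I_9) : (4 ^ k = 4 ^ l %[mod 73])%N -> k = l.
Proof.
(* The powers 4^0, ..., 4^8 modulo 73. *)
pose s := [:: 1; 4; 16; 64; 37; 2; 8; 32; 55]%N.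
have sE (i : 'I_9) : ((4 ^ i) %% 73)%N = nth 0%N s i.
  case: i => i; elim: i => [|i IHi] lti //=.
  rewrite expnS -modnMmr IHi ?(ltnW lti) //=.
  by move: lti {IHi}; do 8!case: i => [|i] //.
rewrite !sE => /eqP; rewrite nth_uniq // => /eqP; exact: val_inj.
Qed.

(* Locked, since unification would otherwise unfold powers into products. *)
HB.lock Definition frob4 (K : finFieldType) k (x : K) : K := x ^+ (4 ^ k).

(** * The trace form on K and its isotropic vectors *)

Section TraceModel.

Variables (K : finFieldType) (w : K).
Hypotheses (cardK : #|K| = (2 ^ 18)%N) (w27 : w ^+ 27 = 1) (w9 : w ^+ 9 != 1).

Lemma pcharK : 2%N \in [pchar K].
Proof. exact: card_finPcharP cardK isT. Qed.

Lemma frob4D k (x y : K) : frob4 k (x + y) = frob4 k x + frob4 k y.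
Proof. by rewrite frob4.unlock -(expnM 2 2) exprD_pow2 ?pcharK. Qed.

Lemma frob4M k (x y : K) : frob4 k (x * y) = frob4 k x * frob4 k y.
Proof. by rewrite frob4.unlock exprMn. Qed.

Lemma frob4_add k l (x : K) : frob4 k (frob4 l x) = frob4 (k + l) x.
Proof. by rewrite frob4.unlock -exprM addnC expnD. Qed.

Lemma frob4_9 (x : K) : frob4 9 x = x.
Proof.
by rewrite frob4.unlock -[in RHS](expf_card x) cardK -(expnM 2 2 9).
Qed.

Lemma frob4_modn k (x : K) : frob4 (k %% 9)%N x = frob4 k x.
Proof.
rewrite [in RHS](divn_eq k 9) addnC -frob4_add; congr frob4.
elim: (k %/ 9)%N => [|n IHn]; first by rewrite frob4.unlock expr1.
by rewrite mulSn -frob4_add -IHn frob4_9.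
Qed.

(** The trace to the subfield of order 64, as [frob4 3] is x |-> x^64. *)
Definition tr (x : K) : K := x + frob4 3 x + frob4 3 (frob4 3 x).

Lemma trD x y : tr (x + y) = tr x + tr y.
Proof. by rewrite /tr !frob4D [RHS]addrACA; congr (_ + _); rewrite addrACA. Qed.

Lemma tr_frob4 k x : tr (frob4 k x) = frob4 k (tr x).
Proof.
have fC (y : K) : frob4 3 (frob4 k y) = frob4 k (frob4 3 y).
  by rewrite !frob4_add addnC.
by rewrite /tr !frob4D !fC; congr (_ + _ + _).
Qed.

Lemma trZ c x : frob4 3 c = c -> tr (c * x) = c * tr x.
Proof.
by move=> c64; rewrite /tr !frob4M !c64 !mulrDr.
Qed.

Lemma two0 : 1 + 1 = 0 :> K.
Proof. exact: (pcharf0 pcharK). Qed.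

Lemma sum_cube_root : 1 + w ^+ 9 + w ^+ 18 = 0.
Proof.
apply: (mulfI (_ : w ^+ 9 - 1 != 0)); first by rewrite subr_eq0.
rewrite mulr0 (exprM w 9 2); have := subrX1 (w ^+ 9) 3.
rewrite !big_ord_recr big_ord0 /= add0r expr0 expr1 => <-.
by rewrite -exprM w27 subrr.
Qed.

(* As [57 * 9 = 1 + 512], these are the nonzero isotropic vectors of the *)
(* hermitian form [tr (x * y ^ 512)].                                    *)
Definition iso (x : K) := (x != 0) && (tr (x ^+ (57 * 9)) == 0).

Lemma cardK1 : #|K|.-1 = (57 * 63 * 73)%N.
Proof.
rewrite cardK (expnM 2 6 3) (predn_exp (2 ^ 6) 3) !big_ord_recr big_ord0 /=.
by rewrite -mulnA mulnCA; congr (_ * _)%N.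
Qed.

Lemma expf_card1K (x : K) : x != 0 -> x ^+ (57 * 63 * 73) = 1.
Proof.
by rewrite -cardK1; apply: expf_card1.
Qed.

(** Applied to y = x^513 and z = x^3591. Here y^64 = y z^9 and y^4096 = y z^9 z^576 = y z, because
    z^73 = 1; so the trace of y is y (1 + z^9 + z). *)
Lemma tr_eq0_root (y z : K) :
  y != 0 -> y ^+ 63 = z ^+ 9 -> z ^+ 73 = 1 -> tr y = 0 -> z ^+ 9 + z + 1 = 0.
Proof.
move=> nz_y yz z73 tr0; apply: (mulfI nz_y); rewrite mulr0 -tr0 /tr.
have yf : frob4 3 y = y * z ^+ 9 by rewrite frob4.unlock -yz -exprS.
have zf : frob4 3 (z ^+ 9) = z ^+ 65.
  by rewrite frob4.unlock -exprM -(expr_mod _ z73).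
have zz : z ^+ 9 * z ^+ 65 = z by rewrite -exprD (exprS z 73) z73 mulr1.
rewrite yf frob4M yf zf -mulrA zz !mulrDr mulr1.
by rewrite addrC addrA.
Qed.

Lemma iso_root x : iso x ->
  [/\ x ^+ (57 * 63 * 73) = 1, x ^+ (57 * 63) != 1
    & x ^+ (57 * 63 * 9) + x ^+ (57 * 63) + 1 = 0].
Proof.
case/andP=> nz_x /eqP tr0; have x1 := expf_card1K nz_x.
have rt : x ^+ (57 * 63 * 9) + x ^+ (57 * 63) + 1 = 0.
  rewrite [x ^+ (_ * 9)]exprM; apply: tr_eq0_root tr0.
  - exact: expf_neq0.
  - by rewrite -!exprM -!mulnA.
  - by rewrite -exprM.
split=> //; apply: contra_eq_neq rt => z1.
by rewrite exprM z1 expr1n two0 add0r oner_neq0.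
Qed.

Lemma size_trinomial n : (0 < n)%N ->
  size ('X^(n * 9) + 'X^n + 1 : {poly K}) = (n * 9).+1.
Proof.
move=> n_gt0; rewrite -addrA size_polyDl ?size_polyXn //.
rewrite (leq_ltn_trans (size_polyD _ _)) // size_poly1 size_polyXn gtn_max.
by rewrite !ltnS muln_gt0 n_gt0 ltn_Pmulr.
Qed.

Lemma card_iso_le : (#|iso| <= 57 * 63 * 9)%N.
Proof.
have sP := size_trinomial (isT : 0 < 57 * 63)%N.
rewrite -ltnS -sP cardE; apply: max_poly_roots.
- by rewrite -size_poly_gt0 sP.
- apply/allP=> x; rewrite mem_enum => /iso_root[_ _ rt].
  by rewrite /root !hornerE; apply/eqP.
exact: enum_uniq.
Qed.

Lemma frob4_root_inj (z : K) (k l : 'I_9) :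
  z ^+ 73 = 1 -> z != 1 -> frob4 k z = frob4 l z -> k = l.
Proof.
move=> z73 nz1; have [d zd d_dvd] := prim_order_exists (isT : 0 < 73)%N z73.
have d73 : d = 73.
  have [] := primeP (isT : prime 73) => _ /(_ d d_dvd)/orP[] /eqP d1 //.
  by case/eqP: nz1; rewrite -(prim_expr_order zd) d1.
rewrite frob4.unlock => /eqP; rewrite (eq_prim_root_expr zd) d73 => /eqP.
exact: pow4_mod73_inj.
Qed.

(* The product of the multiplicative group of the subfield of order 64 with *)
(* the group of the elements of norm [1] over the subfield of order 512.    *)
Definition unit_roots : {set K} := [set t | t ^+ (57 * 63) == 1].

Lemma card_unit_roots : (57 * 63 <= #|unit_roots|)%N.
Proof.
have [g gP] := finField_prim_root K.
rewrite cardK1 in gP.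
have hP := dvdn_prim_root gP (dvdn_mulr 73 (dvdnn (57 * 63))).
rewrite mulKn // in hP; set h := g ^+ 73 in hP.
have h_inj : injective (fun i : 'I_(57 * 63) => h ^+ i).
  move=> i j /eqP; rewrite (eq_prim_root_expr hP) !modn_small ?ltn_ord //.
  by move/eqP/val_inj.
rewrite -[X in (X <= _)%N]card_ord -(card_imset _ h_inj).
apply: subset_leq_card.
apply/subsetP=> _ /imsetP[i _ ->]; rewrite inE exprAC.
by rewrite (prim_expr_order hP) expr1n.
Qed.

Definition semiact k (t x : K) : K := t * frob4 k x.

(** Raising to the power 3591 removes t and u and leaves z^(4^k) = z^(4^l) with z = x^3591 of order
    73, whence k = l; then t = u by cancellation. *)
Lemma semiact_inj (x : K) (k l : 'I_9) t u :
    iso x -> t \in unit_roots -> u \in unit_roots ->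
  semiact k t x = semiact l u x -> k = l /\ t = u.
Proof.
move=> iso_x; rewrite !inE => /eqP t1 /eqP u1 eq_tu.
have [x1 nx1 _] := iso_root iso_x.
have eq_kl : k = l.
  apply: (frob4_root_inj (z := x ^+ (57 * 63))); rewrite -?exprM //.
  have : semiact k t x ^+ (57 * 63) = semiact l u x ^+ (57 * 63).
    by rewrite eq_tu.
  rewrite /semiact 2!exprMn t1 u1 2!mul1r frob4.unlock.
  by rewrite -!exprM ![(4 ^ _ * _)%N]mulnC !exprM.
split=> //; move: eq_tu; rewrite /semiact eq_kl; apply: mulIf.
by rewrite frob4.unlock expf_neq0 //; case/andP: iso_x.
Qed.

(** As 513 * 63 = 9 * 3591, the power t^513 lies in the subfield of order 64. Thus multiplication by
    t only rescales the hermitian form. *)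
Lemma unit_root_norm t : t \in unit_roots ->
  t != 0 /\ frob4 3 (t ^+ (57 * 9)) = t ^+ (57 * 9).
Proof.
rewrite inE => /eqP t1; split.
  by apply: contra_eq_neq t1 => ->; rewrite expr0n eq_sym oner_neq0.
rewrite frob4.unlock (exprS _ 63) -exprM.
by rewrite mulnAC (exprM _ (57 * 63) 9) t1 expr1n mulr1.
Qed.

Lemma tr_semiact k t x : t \in unit_roots ->
  tr ((semiact k t x) ^+ (57 * 9)) =
    t ^+ (57 * 9) * frob4 k (tr (x ^+ (57 * 9))).
Proof.
case/unit_root_norm=> _ t64; rewrite /semiact exprMn -tr_frob4 -trZ //.
by rewrite frob4.unlock exprAC.
Qed.

Lemma iso_semiact k t x : t \in unit_roots -> iso x -> iso (semiact k t x).
Proof.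
move=> Tt /andP[nz_x /eqP tr0]; have [nz_t _] := unit_root_norm Tt.
rewrite /iso tr_semiact // tr0 /semiact mulf_neq0 //.
  by rewrite frob4.unlock expr0n expn_eq0 /= mulr0.
by rewrite frob4.unlock expf_neq0.
Qed.

(* By counting: the maps act freely, and they are at least as many as the *)
(* isotropic vectors.                                                     *)
Lemma semiact_trans (x y : K) : iso x -> iso y ->
  exists (k : 'I_9) t, t \in unit_roots /\ y = semiact k t x.
Proof.
move=> iso_x iso_y; pose f (p : 'I_9 * K) := semiact p.1 p.2 x.
pose D := setX [set: 'I_9] unit_roots.
have f_inj : {in D &, injective f}.
  move=> [k t] [l u]; rewrite !inE /= => Tt Tu eq_f.
  by have [] := semiact_inj iso_x _ _ eq_f; rewrite ?inE //= => -> ->.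
have sub : f @: D \subset [set v | iso v].
  apply/subsetP=> _ /imsetP[[k t] /setXP[_ Tt] ->]; rewrite inE.
  exact: iso_semiact.
have : y \in f @: D.
  suffices -> : f @: D = [set v | iso v] by rewrite inE.
  apply/eqP; rewrite eqEcard sub (card_in_imset f_inj) cardsX cardsT card_ord.
  rewrite cardsE (leq_trans card_iso_le) // mulnC leq_mul2l.
  exact: card_unit_roots.
by case/imsetP=> [[k t] /setXP[_ Tt] ->]; exists k, t.
Qed.

End TraceModel.

(** * Orthonormal coordinates on K over F_64 *)

Section Coordinates.

Variables (K F : finFieldType) (iota : {rmorphism F -> K}) (w : K).
Hypotheses (cardK : #|K| = (2 ^ 18)%N) (cardF : #|F| = 64%N).
Hypotheses (w27 : w ^+ 27 = 1) (w9 : w ^+ 9 != 1).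

Lemma expf64 (c : F) : c ^+ 64 = c.
Proof. by have := expf_card c; rewrite cardF. Qed.

Lemma frob4_iota c : frob4 3 (iota c) = iota c.
Proof. by rewrite frob4.unlock -rmorphXn -[in RHS](expf_card c) cardF. Qed.

Lemma frob4_w i : frob4 3 (w ^+ i) = w ^+ i * w ^+ 9 ^+ i.
Proof.
rewrite frob4.unlock exprAC -exprMn; congr (_ ^+ _).
by rewrite -(expr_mod _ w27) -exprS.
Qed.

(** The map x |-> x^64 multiplies w^n by e^n, where e = w^9 is a primitive cube root of unity. The
    factor 1 + e^n + e^(2n) is 3 = 1 if 3 divides n, and 0 otherwise. *)
Lemma tr_w n : tr (w ^+ n) = (3 %| n)%:R * w ^+ n.
Proof.
have e9 : w ^+ 9 ^+ 9 = 1 by rewrite -exprM (exprM w 27 3) w27 expr1n.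
have fe : frob4 3 (w ^+ 9 ^+ n) = w ^+ 9 ^+ n.
  by rewrite -exprM frob4_w exprM (exprM _ 9 n) e9 expr1n mulr1.
rewrite /tr frob4_w frob4M frob4_w fe -mulrA -expr2 -[X in X + _ + _]mulr1.
rewrite -!mulrDr mulrC; congr (_ * _); set e := w ^+ 9.
have e3 : e ^+ 3 = 1 by rewrite -exprM.
have sum0 : 1 + e + e ^+ 2 = 0 by rewrite -exprM; apply: sum_cube_root.
rewrite -(expr_mod n e3) /dvdn; have := ltn_pmod n (isT : 0 < 3)%N.
case: (n %% 3)%N => [|[|[|//]]] _ /=; rewrite ?expr1n ?two0 ?add0r //.
by rewrite -exprM (exprS e 3) e3 mulr1 addrAC.
Qed.

Lemma tr_ww (i j : 'I_3) : tr (w ^+ i * w ^+ (26 * j)) = (i == j)%:R.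
Proof.
have wn n : w ^+ (n * 27) = 1 by rewrite mulnC exprM w27 expr1n.
rewrite -exprD tr_w; case: i j => [[|[|[|?]]] ?] [[|[|[|?]]] ?] //=;
  rewrite ?mul0r ?mul1r //.
exact: (wn 2).
Qed.

(* [1, w, w ^ 2] is an orthonormal basis of [K] for [tr (x * y ^ 512)], as *)
(* [tr_ww] shows: [w ^ 26] is both [w ^ -1] and [w ^ 512].                 *)
Definition toK (v : 'rV[F]_3) : K := \sum_j iota (v 0 j) * w ^+ j.

Lemma tr_sum (I : Type) (r : seq I) P (f : I -> K) :
  tr (\sum_(i <- r | P i) f i) = \sum_(i <- r | P i) tr (f i).
Proof.
apply: (big_morph _ (trD cardK)).
by apply: (addrI (tr 0)); rewrite -(trD cardK) !addr0.
Qed.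

Lemma tr_iotaZ c x : tr (iota c * x) = iota c * tr x.
Proof. exact/trZ/frob4_iota. Qed.

Lemma tr_toK_w v (j : 'I_3) : tr (toK v * w ^+ (26 * j)) = iota (v 0 j).
Proof.
rewrite mulr_suml tr_sum (bigD1 j) //= big1 => [|i ij].
  by rewrite -mulrA tr_iotaZ tr_ww eqxx mulr1 addr0.
by rewrite -mulrA tr_iotaZ tr_ww (negPf ij) mulr0.
Qed.

Lemma toKD u v : toK (u + v) = toK u + toK v.
Proof.
rewrite /toK -big_split /=; apply: eq_bigr => j _.
by rewrite mxE rmorphD mulrDl.
Qed.

Lemma toKZ c v : toK (c *: v) = iota c * toK v.
Proof.
by rewrite /toK mulr_sumr; apply: eq_bigr => j _; rewrite mxE rmorphM mulrA.
Qed.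

Lemma toK_inj : injective toK.
Proof.
move=> u v uv; apply/rowP=> j; apply: (fmorph_inj iota).
by rewrite -!tr_toK_w uv.
Qed.

(** The standard hermitian form at (v, v): x^9 is the norm from F_64 to F_8. *)
Definition qform (v : 'rV[F]_3) : F := \sum_j v 0 j ^+ 9.

Lemma tr_norm_toK v : tr (toK v ^+ (57 * 9)) = iota (qform v).
Proof.
have -> : toK v ^+ (57 * 9) = toK v * \sum_j iota (v 0 j ^+ 8) * w ^+ (26 * j).
  rewrite (exprS _ (2 ^ 9)); congr (_ * _).
  have eD (x y : K) := exprD_pow2 x y 9 (pcharK cardK).
  rewrite (big_morph _ eD (expr0n _ _)).
  apply: eq_bigr => j _; rewrite exprMn -rmorphXn; congr (iota _ * _).
    by rewrite (_ : 2 ^ 9 = 64 * 8)%N // exprM expf64.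
  rewrite exprAC exprM; congr (_ ^+ j).
  by rewrite -[LHS](expr_mod (2 ^ 9) w27).
rewrite mulr_sumr tr_sum rmorph_sum; apply: eq_bigr => j _.
by rewrite mulrCA tr_iotaZ tr_toK_w -rmorphM -exprSr.
Qed.

Lemma toK_bij : bijective toK.
Proof.
apply: inj_card_bij toK_inj _; rewrite card_mx cardK cardF (expnM 2 6 3).
exact: leqnn.
Qed.

End Coordinates.

(** * Simplicity of PSU(3, 8) *)

Definition i0 : 'I_3 := @Ordinal 3 0 isT.
Definition i1 : 'I_3 := @Ordinal 3 1 isT.
Definition i2 : 'I_3 := @Ordinal 3 2 isT.

Lemma sum_I3 (V : zmodType) (f : 'I_3 -> V) : \sum_i f i = f i0 + f i1 + f i2.
Proof.
rewrite !big_ord_recr big_ord0 /= add0r.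
by congr (f _ + f _ + f _); apply: val_inj.
Qed.

Lemma all_I3 (P : 'I_3 -> Prop) : P i0 -> P i1 -> P i2 -> forall i, P i.
Proof.
move=> P0 P1 P2 [[|[|[|//]]] lti].
- by rewrite (_ : Ordinal lti = i0) //; apply: val_inj.
- by rewrite (_ : Ordinal lti = i1) //; apply: val_inj.
- by rewrite (_ : Ordinal lti = i2) //; apply: val_inj.
Qed.

(** * Explicit 3 by 3 matrices *)

Section Matrix3.

Variable R : comNzRingType.

Definition mx3 (a b c d e f g h i : R) : 'M[R]_3 :=
  \matrix_(k, l)
    nth 0 (nth [::] [:: [:: a; b; c]; [:: d; e; f]; [:: g; h; i]] k) l.

Lemma mx3_eta (X : 'M[R]_3) :
  X = mx3 (X i0 i0) (X i0 i1) (X i0 i2) (X i1 i0) (X i1 i1) (X i1 i2)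
          (X i2 i0) (X i2 i1) (X i2 i2).
Proof. by apply/matrixP; apply: all_I3; apply: all_I3; rewrite mxE. Qed.

Lemma mulmx_I3 m n (X : 'M[R]_(m, 3)) (Y : 'M[R]_(3, n)) i j :
  (X *m Y) i j = X i i0 * Y i0 j + X i i1 * Y i1 j + X i i2 * Y i2 j.
Proof. by rewrite mxE sum_I3. Qed.

Lemma det_lower3 a d e g h i : \det (mx3 a 0 0 d e 0 g h i) = a * e * i.
Proof.
rewrite det_trig; last first.
  by apply/is_trig_mxP; apply: all_I3; apply: all_I3 => // _; rewrite mxE.
by rewrite !big_ord_recr big_ord0 /= mul1r !mxE.
Qed.

End Matrix3.

Ltac mx3calc :=
  apply/matrixP; apply: all_I3; apply: all_I3; rewrite ?mulmx_I3 !mxE /=.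

Definition Jmx (F : finFieldType) : 'M[F]_3 := mx3 0 0 1 0 1 0 1 0 0.

(* The rows are a basis [e, d, f] of [F^3] in which the standard hermitian *)
(* form has Gram matrix [Jmx], as soon as [a] has trace 1.                 *)
Definition Smx (F : finFieldType) (a : F) : 'M[F]_3 :=
  mx3 1 1 0 0 0 1 a (a + 1) 0.

(* [{'GL_3[F]}] is stated with dimension [3.-1.+1]. *)
Definition mxGL (F : finFieldType) (g : {'GL_3[F]}) : 'M[F]_3 := val g.

(* Locked, since unification would otherwise unfold [cg] when reassociating *)
(* matrix products.                                                         *)
HB.lock Definition cg (F : finFieldType) (a : F) (g : {'GL_3[F]}) : 'M[F]_3 :=
  Smx a *m mxGL g *m invmx (Smx a).

(** * SU_3(8) in a hyperbolic basis *)

Section UnitaryModel.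

Variables (F : finFieldType) (s : {rmorphism F -> F}) (a : F).
Hypotheses (cardF : #|F| = 64%N) (sE : forall x, s x = x ^+ 8).
Hypothesis (a_tr : a + s a = 1).

Lemma pchar2 : 2%N \in [pchar F].
Proof. by apply: (@card_finPcharP _ 2 6). Qed.

Lemma addxx (x : F) : x + x = 0. Proof. exact: addrr_pchar2 pchar2 x. Qed.

Lemma sK : involutive s.
Proof. by move=> x; rewrite !sE -exprM -[RHS]expf_card cardF. Qed.

(** For use with [ring], which does not know the characteristic: the doubled term that vanishes is
    supplied as [z]. *)
Lemma eq_char2 (z x y : F) : x = y + (z + z) -> x = y.
Proof. by rewrite addxx addr0. Qed.

Lemma sqr1_char2 (x : F) : x * x = 1 -> x = 1.
Proof.
move=> xx; apply/eqP; rewrite -subr_eq0 -[_ == 0]orbb -mulf_eq0.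
have -> : (x - 1) * (x - 1) = (x * x - 1) - (x - 1 + (x - 1)) by ring.
by rewrite xx addxx subrr subr0.
Qed.

Local Notation Smx := (Smx a).
Local Notation Jmx := (Jmx F).
Local Notation cg := (@cg F a).

Lemma JJ : Jmx *m Jmx = 1%:M.
Proof. mx3calc; ring. Qed.

Lemma s_a : s a = a + 1.
Proof. by rewrite -a_tr addrA addxx add0r. Qed.

Lemma SS : Smx *m (map_mx s Smx)^T = Jmx.
Proof.
mx3calc; rewrite ?(rmorphD, rmorph1, rmorph0) ?s_a; try ring.
- by apply: (eq_char2 (z := 1)); ring.
- by apply: (eq_char2 (z := a + 1)); ring.
- by apply: (eq_char2 (z := a)); ring.
by apply: (eq_char2 (z := a * a + a * 1 + a + 1)); ring.
Qed.

Lemma Smx_unit : Smx \in unitmx.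
Proof.
by have /mulmx1_unit[] : Smx *m ((map_mx s Smx)^T *m Jmx) = 1%:M
  by rewrite mulmxA SS JJ.
Qed.

Lemma map_Smx_unit : map_mx s Smx \in unitmx.
Proof. by rewrite map_unitmx Smx_unit. Qed.

Local Notation G := (SU 3 s).

Lemma cgM g h : cg (g * h)%g = cg g *m cg h.
Proof. by rewrite cg.unlock !mulmxA mulmxKV ?Smx_unit. Qed.

Lemma cg1 : cg 1%g = 1%:M.
Proof. by rewrite cg.unlock mulmx1 mulmxV ?Smx_unit. Qed.

Lemma cgE g : Smx *m mxGL g = cg g *m Smx.
Proof. by rewrite cg.unlock mulmxKV ?Smx_unit. Qed.

Lemma cg_inj : injective cg.
Proof.
move=> g h gh; apply: val_inj.
rewrite -[val g]/(mxGL g) -[val h]/(mxGL h).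
have: Smx *m mxGL g = Smx *m mxGL h by rewrite !cgE gh.
by move/(can_inj (mulKmx Smx_unit)).
Qed.

(* Membership in [SU] read in the basis of the rows of [Smx]. *)
Definition suJ (X : 'M[F]_3) :=
  X *m Jmx *m (map_mx s X)^T = Jmx /\ \det X = 1.

Lemma SUP g : reflect (mxGL g *m (map_mx s (mxGL g))^T = 1%:M
     /\ \det (mxGL g) = 1) (g \in G).
Proof.
rewrite inE; apply: (iffP andP) => -[Ug /eqP dg]; split=> //.
  by apply/mulmx1C/eqP.
by apply/eqP/mulmx1C.
Qed.

Lemma cg_SU g : reflect (suJ (cg g)) (g \in G).
Proof.
have dS : \det (cg g) = \det (mxGL g).
  rewrite cg.unlock !det_mulmx mulrAC -det_mulmx mulmxV ?Smx_unit //.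
  by rewrite det1 mul1r.
have XJX : cg g *m Jmx *m (map_mx s (cg g))^T =
    Smx *m (mxGL g *m (map_mx s (mxGL g))^T) *m
    (map_mx s Smx)^T.
  have E : (map_mx s Smx)^T *m (map_mx s (cg g))^T =
      (map_mx s (mxGL g))^T *m (map_mx s Smx)^T.
    by rewrite -!trmx_mul -!map_mxM -cgE.
  by rewrite -SS mulmxA -cgE -!mulmxA E.
rewrite /suJ dS XJX.
apply: (iffP (SUP g)) => -[Ug dg]; split=> //; first by rewrite Ug mulmx1 SS.
have tS : (map_mx s Smx)^T \in unitmx by rewrite unitmx_tr map_Smx_unit.
apply: (can_inj (mulKmx Smx_unit)); apply: (can_inj (mulmxK tS)).
by rewrite Ug mulmx1 SS.
Qed.

Lemma suJ_exists X : suJ X -> exists2 g, g \in G & cg g = X.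
Proof.
move=> sX; pose Y := invmx Smx *m X *m Smx.
have uY : Y \in unitmx.
  rewrite !unitmx_mul unitmx_inv Smx_unit andbT /=.
  by rewrite unitmxE (proj2 sX) unitr1.
pose g : {'GL_3[F]} := insubd (1%g : {'GL_3[F]}) Y.
have vg : mxGL g = Y by apply: insubdK.
have cgX : cg g = X.
  rewrite cg.unlock vg /Y !mulmxA mulmxV ?Smx_unit // mul1mx.
  by rewrite mulmxK ?Smx_unit.
by exists g => //; apply/cg_SU; rewrite cgX.
Qed.

End UnitaryModel.

(** * Torus, unipotent elements and isotropic vectors *)

Section HyperbolicCoordinates.

Variables (F : finFieldType) (s : {rmorphism F -> F}).
Hypotheses (cardF : #|F| = 64%N) (sE : forall x, s x = x ^+ 8).

Let addxx (x : F) : x + x = 0. Proof. exact: addxx cardF x. Qed.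
Let sK : involutive s. Proof. exact: sK cardF sE. Qed.

Local Notation J := (Jmx F).
Local Notation suJ := (suJ s).

Definition row3 (p q r : F) : 'rV[F]_3 := \row_j nth 0 [:: p; q; r] j.

Lemma row3_eta (x : 'rV[F]_3) : x = row3 (x 0 i0) (x 0 i1) (x 0 i2).
Proof. by apply/rowP; apply: all_I3; rewrite mxE. Qed.

Definition hJ (x y : 'rV[F]_3) : F :=
  x 0 i0 * s (y 0 i2) + x 0 i1 * s (y 0 i1) + x 0 i2 * s (y 0 i0).

Lemma hJE x y : hJ x y = (x *m J *m (map_mx s y)^T) 0 0.
Proof. by rewrite !mulmx_I3 !mxE /= /hJ; ring. Qed.

Lemma hJ_inv X x y : suJ X -> hJ (x *m X) (y *m X) = hJ x y.
Proof.
case=> UX _; rewrite !hJE map_mxM trmx_mul; congr (fun_of_matrix _ _ _).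
by rewrite -!mulmxA; congr (_ *m _); rewrite !mulmxA UX.
Qed.

Lemma suJ_entry X i j : suJ X ->
  X i i0 * s (X j i2) + X i i1 * s (X j i1) + X i i2 * s (X j i0) = J i j.
Proof. by case=> /matrixP/(_ i j) <- _; rewrite !mulmx_I3 !mxE /=; ring. Qed.

Lemma suJM X Y : suJ X -> suJ Y -> suJ (X *m Y).
Proof.
move=> [UX dX] [UY dY]; split; last by rewrite det_mulmx dX dY mulr1.
rewrite map_mxM trmx_mul mulmxA -[X *m Y *m J]mulmxA -(mulmxA X) UY.
exact: UX.
Qed.

Lemma suJ_J : suJ J.
Proof.
split; last by apply: (sqr1_char2 cardF); rewrite -det_mulmx JJ det1.
by mx3calc; rewrite ?(rmorph0, rmorph1); ring.
Qed.

(** The form forces the last entry to be s(c)^-1 = c^-8, and determinant 1 then forces c^7 in the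
    middle. *)
Definition torus (c : F) : 'M[F]_3 := mx3 c 0 0 0 (c ^+ 7) 0 0 0 (c^-1 ^+ 8).

Lemma suJ_torus c : c != 0 -> suJ (torus c).
Proof.
move=> nz_c; have c63 : c ^+ 63 = 1 by rewrite -(expf_card1 nz_c) cardF.
have c1 : c^-1 ^+ 64 = c^-1 by rewrite -[RHS]expf_card cardF.
split; last by rewrite det_lower3 -exprS -exprMn divff ?expr1n.
mx3calc; rewrite ?(rmorph0, rmorph1) ?sE -?exprM; try ring;
  rewrite !(mul0r, mulr0, mulr1, add0r, addr0).
- by rewrite c1 divff.
- by rewrite -exprD.
- by rewrite -exprMn mulVf ?expr1n.
Qed.

Definition unip (b z : F) : 'M[F]_3 := mx3 1 0 0 (s b) 1 0 z b 1.

Lemma suJ_unip b z : z + s z + b * s b = 0 -> suJ (unip b z).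
Proof.
move=> bz; split; last by rewrite det_lower3 !mulr1.
mx3calc; rewrite ?(rmorph0, rmorph1) ?sK; try ring;
  rewrite !(mul0r, mulr0, mulr1, mul1r, add0r, addr0) ?addxx //.
by rewrite -bz; ring.
Qed.

Definition eJ := row3 1 0 0.
Definition fJ := row3 0 0 1.

Lemma row3_torus p q r c :
  row3 p q r *m torus c = row3 (p * c) (q * c ^+ 7) (r * c^-1 ^+ 8).
Proof. by apply/rowP; apply: all_I3; rewrite mulmx_I3 !mxE /=; ring. Qed.

Lemma eJ_unip b z : eJ *m unip b z = eJ.
Proof. by apply/rowP; apply: all_I3; rewrite mulmx_I3 !mxE /=; ring. Qed.

Lemma fJ_unip b z : fJ *m unip b z = row3 z b 1.
Proof. by apply/rowP; apply: all_I3; rewrite mulmx_I3 !mxE /=; ring. Qed.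

Lemma row3_J p q r : row3 p q r *m J = row3 r q p.
Proof. by apply/rowP; apply: all_I3; rewrite mulmx_I3 !mxE /=; ring. Qed.

Lemma hJ_row3 p q r p' q' r' :
  hJ (row3 p q r) (row3 p' q' r') = p * s r' + q * s q' + r * s p'.
Proof. by rewrite /hJ !mxE. Qed.

Lemma row3Z c p q r : c *: row3 p q r = row3 (c * p) (c * q) (c * r).
Proof. by apply/rowP; apply: all_I3; rewrite !mxE. Qed.

(** The Witt index is 1: once the third coordinate vanishes, isotropy says that the ninth power of
    the second is 0. *)
Lemma isoJ_e x : hJ x x = 0 -> hJ x eJ = 0 -> x = x 0 i0 *: eJ.
Proof.
rewrite (row3_eta x) !hJ_row3 row3Z !mxE /= rmorph0 rmorph1 !mulr0 !add0r mulr1.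
move=> hx r0; move: hx; rewrite r0 rmorph0 mulr0 mul0r add0r addr0 sE -exprS.
by move/eqP; rewrite expf_eq0 /= => /eqP->; rewrite mulr1.
Qed.

(** For x = (p, q, r), isotropy divided by r s(r) is exactly the condition of [suJ_unip] on b = q /
    r and z = p / r. *)
Lemma isoJ_unip x : hJ x x = 0 -> hJ x eJ != 0 ->
  exists2 X, suJ X & eJ *m X = eJ /\ hJ x eJ *: (fJ *m X) = x.
Proof.
rewrite (row3_eta x) !hJ_row3 rmorph0 rmorph1 !mulr0 !add0r mulr1.
set p := x 0 i0; set q := x 0 i1; set r := x 0 i2 => hx nz_r.
exists (unip (q / r) (p / r)); last first.
  by rewrite eJ_unip fJ_unip row3Z mulr1 !(mulrC r) !divfK.
apply: suJ_unip; have nz_sr : s r != 0 by rewrite fmorph_eq0.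
apply: (mulIf nz_sr); apply: (mulIf nz_r); rewrite !mul0r -hx !rmorphM !fmorphV.
by field; rewrite nz_r nz_sr.
Qed.

End HyperbolicCoordinates.

(** * Normal subgroups and perfectness of SU_3(8) *)

Section SpecialUnitaryGroup.

Variables (F : finFieldType) (s : {rmorphism F -> F}) (a : F).
Hypotheses (cardF : #|F| = 64%N) (sE : forall x, s x = x ^+ 8).
Hypothesis (a_tr : a + s a = 1).

Local Notation G := (SU_group 3 s).
Local Notation J := (Jmx F).
Local Notation suJ := (suJ s).
Local Notation cg := (@cg F a).
Local Notation hJ := (hJ s).
Local Notation eJ := (eJ F).
Local Notation fJ := (fJ F).
Local Notation torus := (@torus F).

Let addxx (x : F) : x + x = 0. Proof. exact: addxx cardF x. Qed.
Let cgM g h : cg (g * h)%g = cg g *m cg h.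
Proof. exact: cgM cardF a_tr g h. Qed.
Let cg1 : cg 1%g = 1%:M. Proof. exact: cg1 cardF a_tr. Qed.
Let cg_inj : injective cg. Proof. exact: cg_inj cardF a_tr. Qed.
Let cgP g : reflect (suJ (cg g)) (g \in G).
Proof. exact: cg_SU cardF a_tr g. Qed.
Let ex_SU X : suJ X -> exists2 g, g \in G & cg g = X.
Proof. exact: suJ_exists cardF a_tr X. Qed.

Lemma cgV g : cg g^-1%g *m cg g = 1%:M.
Proof. by rewrite -cgM mulVg cg1. Qed.

Lemma act_cgK g : cancel (fun x : 'rV[F]_3 => x *m cg g) (mulmx^~ (cg g^-1%g)).
Proof. by move=> x; rewrite -mulmxA -cgM mulgV cg1 mulmx1. Qed.

Lemma hJ_SU g x y : g \in G -> hJ (x *m cg g) (y *m cg g) = hJ x y.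
Proof. by move/cgP/hJ_inv; apply. Qed.

Lemma hJ_e : hJ eJ eJ = 0.
Proof. by rewrite hJ_row3 rmorph0 !mulr0 mul0r !addr0. Qed.

Lemma hJZ c x y : hJ (c *: x) y = c * hJ x y.
Proof. by rewrite /hJ !mxE; ring. Qed.

Lemma eJ_neq0 : eJ != 0.
Proof.
by apply/eqP => /rowP/(_ i0); rewrite !mxE /=; apply/eqP/oner_neq0.
Qed.

Lemma SU_trans x : x != 0 -> hJ x x = 0 -> exists2 g, g \in G & eJ *m cg g = x.
Proof.
move=> nz_x hx; have [r0|nz_r] := eqVneq (hJ x eJ) 0.
  have xE := isoJ_e sE hx r0; set p := x 0 i0 in xE.
  have nz_p : p != 0 by apply: contraNneq nz_x => p0; rewrite xE p0 scale0r.
  have [g Gg gE] := ex_SU (suJ_torus cardF sE nz_p).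
  by exists g => //; rewrite gE row3_torus xE row3Z !mul0r mul1r mulr1 mulr0.
have [X sX [eX fX]] := isoJ_unip cardF sE hx nz_r; set r := hJ x eJ in nz_r fX.
(* [J] sends e to f and [torus c] scales f by c^-8, which is r^64 = r for c = r^-8. *)
have nz_c : r^-1 ^+ 8 != 0 by rewrite expf_neq0 ?invr_eq0.
have sJt := suJM (suJ_J s cardF) (suJ_torus cardF sE nz_c).
have [g Gg gE] := ex_SU (suJM sJt sX).
exists g; rewrite // gE !mulmxA row3_J row3_torus !mul0r mul1r.
have -> : (r^-1 ^+ 8)^-1 ^+ 8 = r.
  by rewrite -exprVn invrK -exprM -[RHS]expf_card cardF.
by rewrite -[RHS]fX scalemxAl row3Z !mulr0 mulr1.
Qed.

(** Double transitivity on isotropic lines: by [isoJ_unip] the stabilizer of e moves the line of f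
    to every isotropic line other than that of e. *)
Lemma SU_two_trans x y :
    hJ x x = 0 -> hJ x eJ != 0 -> hJ y y = 0 -> hJ y eJ != 0 ->
  exists g, [/\ g \in G, eJ *m cg g = eJ
    & exists2 c, c != 0 & x *m cg g = c *: y].
Proof.
move=> hx rx hy ry.
have [X sX [eX fX]] := isoJ_unip cardF sE hx rx.
have [Y sY [eY fY]] := isoJ_unip cardF sE hy ry.
have [g Gg gE] := ex_SU sX; have [h Gh hE] := ex_SU sY.
have Vg : eJ *m cg g^-1%g = eJ by rewrite -{1}eX -gE act_cgK.
exists (g^-1 * h)%g; split.
- by rewrite groupM ?groupV.
- by rewrite cgM mulmxA Vg hE.
exists (hJ x eJ / hJ y eJ); first by rewrite mulf_neq0 ?invr_eq0.
have -> : x *m cg (g^-1 * h)%g = hJ x eJ *: (fJ *m Y).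
  by rewrite -{1}fX -gE cgM mulmxA -!scalemxAl act_cgK hE.
move: fY ry; set r := hJ y eJ => fY nz_r.
by rewrite -fY scalerA divfK.
Qed.

Lemma a_neq0 : a != 0.
Proof.
by apply: contra_eq_neq a_tr => ->; rewrite rmorph0 addr0 eq_sym oner_neq0.
Qed.

(** Preserving the lines of e and f makes X diagonal, by orthogonality. The line of (a, 1, 1), all
    of whose coordinates are nonzero, then forces equal entries. *)
Lemma fixes_lines_scalar X c d k : suJ X ->
    eJ *m X = c *: eJ -> fJ *m X = d *: fJ ->
    row3 a 1 1 *m X = k *: row3 a 1 1 ->
  X = c%:M.
Proof.
move=> sX /rowP Xe /rowP Xf /rowP Xa.
have := (Xe i0, Xe i1, Xe i2, Xf i0, Xf i1, Xf i2, Xa i0, Xa i1, Xa i2).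
rewrite !mulmx_I3 !mxE /= !(mul0r, mul1r, mulr1, mulr0, add0r, addr0).
move=> [[[[[[[[X00 X01] X02] X20] X21] X22] a0] a1] a2].
have := suJ_entry i1 i2 sX; have := suJ_entry i1 i0 sX.
have := suJ_entry i2 i0 sX.
rewrite X00 X01 X02 X20 X21 X22 !mxE /= rmorph0 !(mul0r, mulr0, add0r, addr0).
move=> dc X12 X10.
have nz_sc : s c != 0.
  by apply: contra_eq_neq dc => ->; rewrite mulr0 eq_sym oner_neq0.
have nz_sd : s d != 0.
  rewrite fmorph_eq0; apply: contra_eq_neq dc => ->.
  by rewrite mul0r eq_sym oner_neq0.
have {}X12 : X i1 i2 = 0 by apply: (mulIf nz_sc); rewrite X12 mul0r.
have {}X10 : X i1 i0 = 0 by apply: (mulIf nz_sd); rewrite X10 mul0r.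
move: a0 a1 a2; rewrite X00 X01 X02 X20 X21 X22 X12 X10 !(mulr0, add0r, addr0).
move=> ack X11 dk.
have cd : c = d by apply: (mulfI a_neq0); rewrite ack -dk mulrC.
by rewrite (mx3_eta X) X00 X01 X02 X10 X11 X12 X20 X21 X22 -dk -cd; mx3calc.
Qed.

Lemma scalar_center g c : g \in G -> cg g = c%:M -> g \in 'Z(G)%g.
Proof.
move=> Gg gE; apply/centerP; split=> // h Gh.
by apply: cg_inj; rewrite !cgM gE scalar_mxC.
Qed.

(** If H fixed the line of e, then by normality and [SU_trans] it would fix every isotropic line,
    hence consist of scalars. *)
Lemma normal_moves (H : {group {'GL_3[F]}}) :
    (H <| G)%g -> ~~ (H \subset 'Z(G))%g ->
  exists2 h, h \in H & hJ (eJ *m cg h) eJ != 0.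
Proof.
move=> nHG; case/subsetPn=> h0 Hh0 nZ.
apply/exists_inP; apply: contraR nZ => /exists_inPn fixe.
have sHG := subsetP (normal_sub nHG).
have fixl h x : h \in H -> x != 0 -> hJ x x = 0 -> exists c, x *m cg h = c *: x.
  move=> Hh nz_x hx; have [g Gg gx] := SU_trans nz_x hx.
  have Hhg : (h ^ g^-1 \in H)%g.
    by rewrite memJ_norm // (subsetP (normal_norm nHG)) ?groupV.
  have /negPn/eqP e0 := fixe _ Hhg.
  have hh : hJ (eJ *m cg (h ^ g^-1)%g) (eJ *m cg (h ^ g^-1)%g) = 0.
    by rewrite hJ_SU ?hJ_e ?sHG.
  have := isoJ_e sE hh e0; set c := (X in X *: _) => ce; exists c.
  rewrite -gx scalemxAl -ce -[LHS]mulmxA -[RHS]mulmxA -!cgM; congr (_ *m cg _).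
  by rewrite conjgE invgK -!mulgA mulVg mulg1.
have f_iso : hJ fJ fJ = 0 by rewrite hJ_row3 rmorph0 !(mulr0, mul0r, addr0).
have a_iso : hJ (row3 a 1 1) (row3 a 1 1) = 0.
  by rewrite hJ_row3 !rmorph1 !mulr1 mul1r addrAC a_tr addxx.
have nz_f : fJ != 0.
  by apply/eqP => /rowP/(_ i2); rewrite !mxE /=; apply/eqP/oner_neq0.
have nz_a : row3 a 1 1 != 0.
  by apply/eqP => /rowP/(_ i2); rewrite !mxE /=; apply/eqP/oner_neq0.
have Gh0 := sHG _ Hh0.
have [c ce] := fixl _ _ Hh0 eJ_neq0 hJ_e.
have [d df] := fixl _ _ Hh0 nz_f f_iso.
have [k ka] := fixl _ _ Hh0 nz_a a_iso.
apply: (scalar_center (c := c)) => //.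
by apply: fixes_lines_scalar ce df ka; apply/cgP.
Qed.

(** Conjugating [h1] by the stabilizer of e moves the image of the line of e to any other isotropic
    line, so H is transitive on these lines. *)
Lemma normal_trans (H : {group {'GL_3[F]}}) h1 g :
    (H <| G)%g -> h1 \in H -> hJ (eJ *m cg h1) eJ != 0 -> g \in G ->
  exists h c, [/\ h \in H, c != 0 & eJ *m cg h = c *: (eJ *m cg g)].
Proof.
move=> nHG Hh1 mv Gg; set v := eJ *m cg g.
have hv : hJ v v = 0 by rewrite hJ_SU ?hJ_e.
have [r0|nz_r] := eqVneq (hJ v eJ) 0.
  have vE := isoJ_e sE hv r0; set p := v 0 i0 in vE.
  have nz_p : p != 0.
    apply: contraTneq isT => p0; have := eJ_neq0.
    by rewrite -(act_cgK g eJ) -/v vE p0 scale0r mul0mx eqxx.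
  exists 1%g, p^-1; split; rewrite ?invr_eq0 //.
  by rewrite cg1 mulmx1 vE scalerA mulVf ?scale1r.
have Gh1 : h1 \in G := subsetP (normal_sub nHG) _ Hh1.
have hx : hJ (eJ *m cg h1) (eJ *m cg h1) = 0 by rewrite hJ_SU ?hJ_e.
have [k [Gk ek [c nz_c xk]]] := SU_two_trans hx mv hv nz_r.
exists (h1 ^ k)%g, c; split=> //.
  by rewrite memJ_norm // (subsetP (normal_norm nHG)).
have ekV : eJ *m cg k^-1%g = eJ by rewrite -{1}ek act_cgK.
by rewrite conjgE !cgM !mulmxA ekV xk.
Qed.

(** By [isoJ_e], orthogonality to e means that the isotropic line of e is preserved. *)
Definition line_stab := [set g in G | hJ (eJ *m cg g) eJ == 0].

Lemma line_stabP g :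
  reflect (g \in G /\ exists2 c, c != 0 & eJ *m cg g = c *: eJ)
    (g \in line_stab).
Proof.
apply: (iffP setIdP) => -[Gg].
  move/eqP=> r0; split=> //.
  have hv : hJ (eJ *m cg g) (eJ *m cg g) = 0 by rewrite hJ_SU ?hJ_e.
  have vE := isoJ_e sE hv r0; exists ((eJ *m cg g) 0 i0) => //.
  apply: contraTneq isT => p0; have := eJ_neq0.
  by rewrite -(act_cgK g eJ) vE p0 scale0r mul0mx eqxx.
by case=> c _ ce; rewrite ce hJZ hJ_e mulr0.
Qed.

Lemma line_stab_group_set : group_set line_stab.
Proof.
apply/group_setP; split=> [|g h].
  apply/line_stabP; split; first exact: group1.
  by exists 1; rewrite ?oner_neq0 // cg1 mulmx1 scale1r.
case/line_stabP=> Gg [c nzc ce] /line_stabP[Gh [d nzd de]].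
apply/line_stabP; split; first exact: groupM.
exists (c * d); first by rewrite mulf_neq0.
by rewrite cgM mulmxA ce -scalemxAl de scalerA.
Qed.
Canonical line_stab_group := Group line_stab_group_set.

Definition vec_stab := [set g in G | eJ *m cg g == eJ].

Lemma vec_stabP g : reflect (g \in G /\ eJ *m cg g = eJ) (g \in vec_stab).
Proof. by apply: (iffP setIdP) => -[Gg /eqP]. Qed.

Lemma vec_stab_group_set : group_set vec_stab.
Proof.
apply/group_setP; split=> [|g h /vec_stabP[Gg ge] /vec_stabP[Gh he]].
  by apply/vec_stabP; rewrite cg1 mulmx1 group1.
by apply/vec_stabP; rewrite groupM // cgM mulmxA ge he.
Qed.
Canonical vec_stab_group := Group vec_stab_group_set.

(** The Frattini argument for H acting on isotropic lines. *)
Lemma SU_line_stab (H : {group {'GL_3[F]}}) h1 :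
    (H <| G)%g -> h1 \in H -> hJ (eJ *m cg h1) eJ != 0 ->
  G \subset (line_stab * H)%g.
Proof.
move=> nHG Hh1 mv; apply/subsetP=> g Gg.
have [h [c [Hh nzc he]]] := normal_trans nHG Hh1 mv Gg.
have Gh : h \in G := subsetP (normal_sub nHG) _ Hh.
apply/imset2P; exists (g * h^-1)%g h => //; last by rewrite mulgKV.
apply/line_stabP; split; first by rewrite groupM ?groupV.
exists c^-1; first by rewrite invr_eq0.
have -> : eJ *m cg (g * h^-1)%g = c^-1 *: (eJ *m cg h *m cg h^-1%g).
  by rewrite he -!scalemxAl scalerA mulVf // scale1r cgM mulmxA.
by rewrite act_cgK.
Qed.

Lemma vec_stab_shape g : g \in vec_stab ->
  exists x y z, cg g = mx3 1 0 0 x 1 0 z y 1.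
Proof.
case/vec_stabP=> /cgP sX /rowP Xe.
have := (Xe i0, Xe i1, Xe i2).
rewrite !mulmx_I3 !mxE /= !(mul0r, mul1r, mulr1, mulr0, add0r, addr0).
move=> [[X00 X01] X02].
have := suJ_entry i1 i0 sX; have := suJ_entry i2 i0 sX.
rewrite X00 X01 X02 !mxE /= rmorph0 rmorph1 !(mulr1, mulr0, add0r, addr0).
move=> X22 X12; have := proj2 sX; rewrite (mx3_eta (cg g)) X00 X01 X02 X22 X12.
by rewrite det_lower3 mul1r mulr1 => ->; do 3![eexists].
Qed.

Lemma vec_stab_exp4 g : g \in vec_stab -> (g ^+ 4 = 1)%g.
Proof.
case/vec_stab_shape=> x [y [z gE]]; apply: cg_inj.
have g2 : cg (g * g)%g = mx3 1 0 0 0 1 0 (y * x) 0 1.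
  rewrite cgM gE; mx3calc; try ring.
  - by apply: (eq_char2 cardF (z := x)); ring.
  - by apply: (eq_char2 cardF (z := z)); ring.
  by apply: (eq_char2 cardF (z := y)); ring.
have -> : (g ^+ 4 = (g * g) * (g * g))%g.
  by rewrite !expgS expg0 mulg1 !mulgA.
rewrite cgM g2 cg1; mx3calc; try ring.
by apply: (eq_char2 cardF (z := y * x)); ring.
Qed.

Lemma vec_stab_2group : (2.-group vec_stab)%g.
Proof.
apply/pgroupP=> q q_pr /(Cauchy q_pr)[x Ux oxq].
have q4 : (q %| 2 ^ 2)%N by rewrite -oxq order_dvdn vec_stab_exp4.
by move: q4; rewrite Euclid_dvdX // => /andP[q2 _]; rewrite inE -dvdn_prime2.
Qed.

(** The scalar by which an element acts on e is a multiplicative character, so commutators fix e and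
    the derived subgroup lies in the 2-group [vec_stab]. *)
Lemma line_stab_sol : solvable line_stab.
Proof.
have nDB := der_normal 1 line_stab_group.
rewrite (series_sol nDB) (abelian_sol (der_abelian 0 _)) andbT.
apply: solvableS (pgroup_sol vec_stab_2group).
rewrite gen_subG; apply/subsetP=> _ /imset2P[g h Bg Bh ->].
have Rgh : ([~ g, h] \in line_stab)%g by rewrite groupR.
case/line_stabP: Rgh => GR _; apply/vec_stabP; split=> //.
case/line_stabP: Bg Bh => Gg [c nzc ce] /line_stabP[Gh [d nzd de]].
have gV (k : {'GL_3[F]}) u : u != 0 -> eJ *m cg k = u *: eJ ->
    eJ *m cg k^-1%g = u^-1 *: eJ.
  move=> nzu ku; rewrite -{2}(act_cgK k eJ) ku -scalemxAl scalerA.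
  by rewrite mulVf ?scale1r.
rewrite commgEl conjgE !cgM !mulmxA (gV _ _ nzc ce) -!scalemxAl (gV _ _ nzd de).
rewrite -!scalemxAl ce -!scalemxAl de !scalerA.
rewrite [X in X *: _](_ : _ = 1) ?scale1r //; field.
by rewrite nzc nzd.
Qed.

Definition dg (x y z : F) : 'M[F]_3 := mx3 x 0 0 0 y 0 0 0 z.

Lemma dgM x y z x' y' z' :
  dg x y z *m dg x' y' z' = dg (x * x') (y * y') (z * z').
Proof. by mx3calc; ring. Qed.

Lemma J_dg x y z : J *m dg x y z *m J = dg z y x.
Proof. by mx3calc; ring. Qed.

Lemma torusE c : torus c = dg c (c ^+ 7) (c^-1 ^+ 8).
Proof. by []. Qed.

Lemma cg_torus_mul b c : torus b *m torus c = torus (b * c).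
Proof. by mx3calc; rewrite ?invfM ?exprMn; ring. Qed.

Lemma cg_torusV t b : b != 0 -> cg t = torus b -> cg t^-1%g = torus b^-1.
Proof.
move=> nzb tb; have u1 := cgV t; rewrite tb in u1.
have u2 : torus b *m torus b^-1 = 1%:M.
  by rewrite cg_torus_mul divff //; mx3calc; rewrite ?invr1 ?expr1n; ring.
by rewrite -[LHS]mulmx1 -u2 mulmxA u1 mul1mx.
Qed.

(* The torus is in the derived group: an element is the product of one of  *)
(* order dividing 7, the commutator of a torus element with [J], and one of *)
(* order dividing 9, which is diagonal in the standard basis and a product  *)
(* of two commutators with permutation matrices.                            *)
Lemma torus_F8_der t c : c != 0 -> cg t = torus (c^-1 ^+ 9) -> (t \in G^`(1))%g.
Proof.
move=> nzc tE; have [u Gu uE] := ex_SU (suJ_torus cardF sE nzc).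
have [w Gw wE] := ex_SU (suJ_J s cardF).
have wV : cg w^-1%g = J.
  have u1 := cgV w; rewrite wE in u1.
  by rewrite -[LHS]mulmx1 -(JJ F) mulmxA u1 mul1mx.
suffices -> : t = [~ u, w]%g by rewrite mem_commg.
apply: cg_inj; rewrite commgEl conjgE !cgM (cg_torusV nzc uE) wV uE wE tE.
have c63 : c ^+ 63 = 1 by rewrite -(expf_card1 nzc) cardF.
have cc : c^-1 ^+ 9 ^+ 7 = 1 by rewrite -exprM exprVn c63 invr1.
rewrite [J *m _]mulmxA !torusE J_dg dgM; congr dg.
  by rewrite cc -exprMn mulVf ?expr1n.
by rewrite !exprVn !invrK -exprM (exprD c 63 9) c63 mul1r -exprSr.
Qed.

Lemma ex_SU_std (Y : 'M[F]_3) : Y *m (map_mx s Y)^T = 1%:M -> \det Y = 1 ->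
  exists2 g, g \in G & mxGL g = Y.
Proof.
move=> UY dY; have uY : Y \in unitmx by rewrite unitmxE dY unitr1.
exists (insubd (1%g : {'GL_3[F]}) Y); last exact: insubdK.
by apply/SUP; rewrite /mxGL insubdK.
Qed.

Lemma ex_SU_dg x y z :
    x ^+ 9 = 1 -> y ^+ 9 = 1 -> z ^+ 9 = 1 -> x * y * z = 1 ->
  exists2 g, g \in G & mxGL g = dg x y z.
Proof.
move=> x9 y9 z9 xyz; apply: ex_SU_std; last by rewrite det_lower3.
by mx3calc; rewrite ?rmorph0 ?sE; try ring;
   rewrite !(mul0r, mulr0, add0r, addr0) -exprS.
Qed.

Lemma mxGL_comm g h (X X' Y : 'M[F]_3) :
    mxGL g = X -> X' *m X = 1%:M -> mxGL h = Y -> Y *m Y = 1%:M ->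
  mxGL [~ g, h]%g = X' *m (Y *m X *m Y).
Proof.
move=> gX XX hY YY.
have mM u v : mxGL (u * v)%g = mxGL u *m mxGL v by [].
have m1 : mxGL (1%g : {'GL_3[F]}) = 1%:M by [].
have gV : mxGL g^-1%g = X'.
  by rewrite -[LHS]mul1mx -XX -gX -mulmxA -mM mulgV m1 mulmx1.
have hV : mxGL h^-1%g = Y.
  by rewrite -[LHS]mul1mx -YY -{2}hY -mulmxA -mM mulgV m1 mulmx1.
by rewrite commgEl conjgE !mM gV hV gX hY -[Y *m X *m Y]mulmxA.
Qed.

Definition swap12 : 'M[F]_3 := mx3 1 0 0 0 0 1 0 1 0.

Lemma swap12K : swap12 *m swap12 = 1%:M.
Proof. by mx3calc; ring. Qed.

Lemma swap12_dg x y z : swap12 *m dg x y z *m swap12 = dg x z y.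
Proof. by mx3calc; ring. Qed.

Lemma torus_9_der t b : b ^+ 9 = 1 -> cg t = torus b -> (t \in G^`(1))%g.
Proof.
move=> b9 tE; have nzb : b != 0.
  by apply: contra_eq_neq b9 => ->; rewrite expr0n eq_sym oner_neq0.
have bV9 : b^-1 ^+ 9 = 1 by rewrite exprVn b9 invr1.
have [j Gj jE] : exists2 g, g \in G & mxGL g = J.
  apply: ex_SU_std; last exact: (proj2 (suJ_J s cardF)).
  by mx3calc; rewrite ?rmorph0 ?rmorph1; ring.
have [k Gk kE] : exists2 g, g \in G & mxGL g = swap12.
  apply: ex_SU_std; last first.
    by apply: (sqr1_char2 cardF); rewrite -det_mulmx swap12K det1.
  by mx3calc; rewrite ?rmorph0 ?rmorph1; ring.
have [u Gu uE] : exists2 g, g \in G & mxGL g = dg 1 b^-1 b.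
  by apply: ex_SU_dg; rewrite ?expr1n // mul1r mulVf.
have [v Gv vE] : exists2 g, g \in G & mxGL g = dg b^-1 1 b.
  by apply: ex_SU_dg; rewrite ?expr1n // mulr1 mulVf.
suffices -> : t = ([~ u, j] * [~ v, k])%g by rewrite groupM ?mem_commg.
have dg1 : dg 1 1 1 = 1%:M by mx3calc.
have uV : dg 1 b b^-1 *m dg 1 b^-1 b = 1%:M.
  by rewrite dgM !mulr1 mulfV // mulVf.
have vV : dg b 1 b^-1 *m dg b^-1 1 b = 1%:M.
  by rewrite dgM !mulr1 mulfV // mulVf.
have rE : mxGL ([~ u, j] * [~ v, k])%g = dg b b (b^-1 * b^-1).
  rewrite -[LHS]/(mxGL [~ u, j]%g *m mxGL [~ v, k]%g).
  rewrite (mxGL_comm uE uV jE (JJ F)) (mxGL_comm vE vV kE swap12K).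
  rewrite J_dg swap12_dg !dgM !mul1r !mulr1 mulfV //.
  by rewrite !mul1r !mulr1.
(* The vectors e and f span the first two standard coordinates and d is the third, so diag(b, b,
   b^-2) becomes diag(b, b^-2, b), which is [torus b] as b^9 = 1. *)
apply: cg_inj; rewrite tE cg.unlock rE.
apply: (can_inj (mulmxK (Smx_unit cardF a_tr))).
rewrite (mulmxKV (Smx_unit cardF a_tr)).
have b7 : b ^+ 7 = b^-1 * b^-1.
  by apply: (mulIf nzb); apply: (mulIf nzb); rewrite -!exprSr b9 mulfVK ?mulVf.
have b8 : b^-1 ^+ 8 = b.
  by apply: (mulfI (_ : b^-1 != 0)); rewrite ?invr_eq0 // -exprS bV9 mulVf.
by rewrite /torus b7 b8; mx3calc; ring.
Qed.

Lemma torus_der t c : c != 0 -> cg t = torus c -> (t \in G^`(1))%g.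
Proof.
move=> nzc tE; have c63 : c ^+ 63 = 1 by rewrite -(expf_card1 nzc) cardF.
have nz3 : c ^+ 3 != 0 by rewrite expf_neq0.
have nzy : (c ^+ 3)^-1 ^+ 9 != 0 by rewrite expf_neq0 ?invr_eq0.
have nzb : c ^+ 28 != 0 by rewrite expf_neq0.
have [u Gu uE] := ex_SU (suJ_torus cardF sE nzy).
have [v Gv vE] := ex_SU (suJ_torus cardF sE nzb).
(* Here c = c^-27 c^28, with factors of order dividing 7 and 9 because c^63 = 1. *)
suffices -> : t = (u * v)%g.
  rewrite groupM ?(torus_F8_der nz3 uE) //; apply: torus_9_der vE.
  by rewrite -exprM (exprM c 63 4) c63 expr1n.
apply: cg_inj; rewrite cgM uE vE tE cg_torus_mul; congr torus.
apply: (mulfI (_ : c ^+ 27 != 0)); first exact: expf_neq0.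
by rewrite mulrA -exprSr -exprVn -exprM exprVn mulfV ?mul1r ?expf_neq0.
Qed.

Lemma mulf_fix_eq0 (p q : F) : q != 1 -> p * q = p -> p = 0.
Proof.
move=> q1 pq; have /eqP : p * (q - 1) = 0 by rewrite mulrBr mulr1 pq subrr.
by rewrite mulf_eq0 subr_eq0 (negPf q1) orbF => /eqP.
Qed.

Lemma exists_torus_F8 : exists y : F, [/\ y != 0, y ^+ 7 = 1 & y != 1].
Proof.
have [g] := finField_prim_root F; rewrite cardF => gP.
have g63 := prim_expr_order gP; exists (g ^+ 9); split.
- rewrite expf_neq0 //; apply: contra_eq_neq g63 => ->.
  by rewrite expr0n eq_sym oner_neq0.
- by rewrite -exprM.
by rewrite -(prim_order_dvd gP).
Qed.

(** A torus element of order 7 normalizes [vec_stab] and centralizes none of its nontrivial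
    elements, so [commg_surj] applies. *)
Lemma vec_stab_der : vec_stab \subset (G^`(1))%g.
Proof.
have [y [nzy y7 ny1]] := exists_torus_F8.
have [t Gt tE] := ex_SU (suJ_torus cardF sE nzy).
have tV := cg_torusV nzy tE.
have eT c : eJ *m torus c = c *: eJ.
  by rewrite row3_torus row3Z !mul0r !mulr0 mul1r mulr1.
have nUt : t \in 'N(vec_stab)%g.
  rewrite inE; apply/subsetP=> _ /imsetP[u /vec_stabP[Gu ue] ->].
  apply/vec_stabP; rewrite groupJ // conjgE !cgM !mulmxA tV tE eT.
  rewrite -!scalemxAl ue.
  by rewrite eT scalerA mulVf ?scale1r.
have y8 : y^-1 ^+ 8 = y^-1 by rewrite exprVn exprS y7 mulr1.
have y2 : y * y != 1 by apply: contra ny1 => /eqP/(sqr1_char2 cardF)->.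
have CU1 v : v \in vec_stab -> commute v t -> v = 1%g.
  move=> Uv vt; have [x [w [z vE]]] := vec_stab_shape Uv.
  have : cg v *m cg t = cg t *m cg v by rewrite -!cgM vt.
  rewrite vE tE => /matrixP eq_vt; apply: cg_inj; rewrite cg1 vE.
  have := (eq_vt i1 i0, eq_vt i2 i0, eq_vt i2 i1).
  rewrite !mulmx_I3 !mxE /= y7 y8 !(mul0r, mulr0, mulr1, mul1r, add0r, addr0).
  move=> [[xy zy] wy].
  have x0 : x = 0 by apply: mulf_fix_eq0 ny1 xy.
  have w0 : w = 0 by apply: mulf_fix_eq0 ny1 _; rewrite {1}wy mulrC mulVKf.
  have z0 : z = 0 by apply: mulf_fix_eq0 y2 _; rewrite mulrA zy mulrC mulVKf.
  by rewrite x0 z0 w0; mx3calc.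
apply/subsetP=> u Uu; have [v Uv ->] := commg_surj nUt CU1 Uu.
by case/vec_stabP: Uv => Gv _; apply: mem_commg.
Qed.

Lemma line_stab_der : line_stab \subset (G^`(1))%g.
Proof.
apply/subsetP=> g /line_stabP[Gg [c nzc ge]].
have [t Gt tE] := ex_SU (suJ_torus cardF sE nzc).
rewrite -(mulgKV t g) groupM //; last exact: torus_der tE.
apply: (subsetP vec_stab_der); apply/vec_stabP.
rewrite groupM ?groupV //; split=> //.
rewrite cgM mulmxA ge (cg_torusV nzc tE) -scalemxAl.
by rewrite row3_torus row3Z !mul0r !mulr0 !mul1r mulfV.
Qed.

(** Commuting with diag(y, 1, y^-1), whose entries are distinct, forces a diagonal matrix; commuting
    with [unip 1 a] makes its entries equal. *)
Lemma SU_center g : g \in 'Z(G)%g -> exists c, cg g = c%:M.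
Proof.
case/centerP=> Gg cGg; have [y [nzy y7 ny1]] := exists_torus_F8.
have [t Gt tE] := ex_SU (suJ_torus cardF sE nzy).
have y8 : y^-1 ^+ 8 = y^-1 by rewrite exprVn exprS y7 mulr1.
have y2 : y * y != 1 by apply: contra ny1 => /eqP/(sqr1_char2 cardF)->.
have uni : a + s a + 1 * s 1 = 0 by rewrite a_tr rmorph1 mulr1 addxx.
have [u Gu uE] := ex_SU (suJ_unip cardF sE uni).
have : cg g *m cg t = cg t *m cg g by rewrite -!cgM cGg.
have : cg g *m cg u = cg u *m cg g by rewrite -!cgM cGg.
rewrite uE tE => /matrixP eq_u /matrixP eq_t.
have := (eq_t i0 i1, eq_t i0 i2, eq_t i1 i0, eq_t i1 i2, eq_t i2 i0,
  eq_t i2 i1).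
rewrite !mulmx_I3 !mxE /= y7 y8 !(mul0r, mulr0, mulr1, mul1r, add0r, addr0).
move=> [[[[[t01 t02] t10] t12] t20] t21].
have X01 : cg g i0 i1 = 0 by apply: mulf_fix_eq0 ny1 _; rewrite {2}t01 mulrC.
have X02 : cg g i0 i2 = 0.
  by apply: mulf_fix_eq0 y2 _; rewrite mulrA (mulrC (cg g i0 i2)) -t02 divfK.
have X10 : cg g i1 i0 = 0 by apply: mulf_fix_eq0 ny1 _.
have X12 : cg g i1 i2 = 0 by apply: mulf_fix_eq0 ny1 _; rewrite -{1}t12 divfK.
have X20 : cg g i2 i0 = 0.
  by apply: mulf_fix_eq0 y2 _; rewrite mulrA t20 mulrC mulVKf.
have X21 : cg g i2 i1 = 0.
  by apply: mulf_fix_eq0 ny1 _; rewrite {1}t21 mulrC mulVKf.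
have := (eq_u i1 i0, eq_u i2 i1).
rewrite !mulmx_I3 !mxE /= rmorph1 ?(X01, X02, X10, X12, X20, X21).
rewrite !(mul0r, mulr0, mulr1, mul1r, add0r, addr0) => -[X11 X22].
exists (cg g i0 i0); rewrite [LHS]mx3_eta X01 X02 X10 X12 X20 X21 X22 X11.
by mx3calc.
Qed.

Lemma SU_sub_line_stab_mul (H : {group {'GL_3[F]}}) :
  (H <| G)%g -> ~~ (H \subset 'Z(G))%g -> G \subset (line_stab * H)%g.
Proof.
by move=> nHG nZ; have [h Hh mv] := normal_moves nHG nZ; apply: SU_line_stab mv.
Qed.

Lemma der_SU_noncentral : ~~ (G^`(1) \subset 'Z(G))%g.
Proof.
have [y [nzy y7 ny1]] := exists_torus_F8.
have [t Gt tE] := ex_SU (suJ_torus cardF sE nzy).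
apply/subsetPn; exists t; first exact: torus_der tE.
apply: contra ny1 => /SU_center[c tc].
move: tE; rewrite tc => /matrixP tE; have := (tE i0 i0, tE i1 i1).
by rewrite !mxE /= y7 => -[<- ->].
Qed.

Lemma SU_noncentral : ~~ (G \subset 'Z(G))%g.
Proof. by apply: contra der_SU_noncentral; apply/subset_trans/der_sub. Qed.

Lemma SU_perfect : G^`(1)%g = G.
Proof.
apply/eqP; rewrite eqEsubset der_sub /=.
have sG := SU_sub_line_stab_mul (der_normal 1 G) der_SU_noncentral.
by apply: subset_trans sG _; rewrite mul_subG ?line_stab_der.
Qed.

(* A noncentral [H] is transitive on isotropic lines, so [G / H] is a      *)
(* quotient of the solvable group [line_stab] and is perfect, hence trivial. *)
Lemma SU_normal (H : {group {'GL_3[F]}}) : (H <| G)%g ->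
  (H \subset 'Z(G))%g \/ H :=: G.
Proof.
move=> nHG; have [|nZ] := boolP (H \subset 'Z(G))%g; [by left | right].
have sG := SU_sub_line_stab_mul nHG nZ.
have solGH : solvable (G / H).
  have sGBH : (G / H \subset line_stab / H)%g.
    by rewrite -(quotientMidr H line_stab) quotientS.
  exact: solvableS sGBH (quotient_sol H line_stab_sol).
apply/eqP; rewrite eqEsubset normal_sub //= -quotient_sub1 ?normal_norm //.
have [->|ntGH] := eqVneq (G / H)%g 1%g; first exact: subxx.
have := sol_der1_proper solGH (subxx _) ntGH.
by rewrite -quotient_der ?normal_norm // SU_perfect properxx.
Qed.

End SpecialUnitaryGroup.

(** * The factorization of PSU(3, 8) *)

Section HermitianForm.

Variables (F : finFieldType) (s : {rmorphism F -> F}) (a : F).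
Hypotheses (cardF : #|F| = 64%N) (sE : forall x, s x = x ^+ 8).
Hypothesis (a_tr : a + s a = 1).

Lemma qformE (v : 'rV[F]_3) : qform v = (v *m (map_mx s v)^T) 0 0.
Proof. by rewrite mxE; apply: eq_bigr => j _; rewrite !mxE sE exprS. Qed.

Lemma qform_SU g (v : 'rV[F]_3) : g \in SU 3 s -> qform (v *m mxGL g) = qform v.
Proof.
case/SUP=> Ug _; rewrite !qformE map_mxM trmx_mul.
by rewrite mulmxA -(mulmxA v) Ug mulmx1.
Qed.

Lemma qform_hJ (x : 'rV[F]_3) : qform (x *m Smx a) = hJ s x x.
Proof.
rewrite qformE map_mxM trmx_mul mulmxA -(mulmxA x) (SS cardF a_tr).
by rewrite hJE.
Qed.

(** Expanding at u + c v gives s(c) h(u, v) + c h(v, u) = 0. Comparing c = 1 with a c not fixed by s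
    yields h(u, v) = 0. *)
Lemma polarization (H : 'M[F]_3) :
  (forall v : 'rV[F]_3, (v *m H *m (map_mx s v)^T) 0 0 = 0) -> H = 0.
Proof.
move=> H0; pose h (u v : 'rV[F]_3) := (u *m H *m (map_mx s v)^T) 0 0.
have hD1 u u' v : h (u + u') v = h u v + h u' v by rewrite /h !mulmxDl mxE.
have hD2 u v v' : h u (v + v') = h u v + h u v'.
  by rewrite /h map_mxD linearD mulmxDr mxE.
have hZ1 c u v : h (c *: u) v = c * h u v by rewrite /h -!scalemxAl mxE.
have hZ2 c u v : h u (c *: v) = s c * h u v.
  by rewrite /h map_mxZ linearZ -scalemxAr mxE.
have hN c u v : s c * h u v + c * h v u = 0.
  have := H0 (u + c *: v); rewrite -/(h _ _) hD1 !hD2 hZ1 !hZ2 hZ1.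
  by rewrite [h u u]H0 [h v v]H0 !mulr0 addr0 add0r.
have [c nc] : exists c, s c - c != 0.
  have [g] := finField_prim_root F; rewrite cardF => gP; exists g.
  by rewrite subr_eq0 sE -[X in _ == X]expr1 (eq_prim_root_expr gP).
have h0 u v : h u v = 0.
  have := hN c u v; have := hN 1 u v; rewrite rmorph1 !mul1r => /eqP.
  rewrite addrC addr_eq0 => /eqP->; rewrite mulrN -mulrBl => /eqP.
  by rewrite mulf_eq0 (negPf nc) => /eqP.
apply/matrixP=> i j; rewrite mxE -(h0 (delta_mx 0 i) (delta_mx 0 j)).
by rewrite /h -rowE map_delta_mx trmx_delta -colE !mxE.
Qed.

Lemma qform_unitary (Y : 'M[F]_3) :
  (forall v : 'rV[F]_3, qform (v *m Y) = qform v) ->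
  Y *m (map_mx s Y)^T = 1%:M.
Proof.
move=> qY; apply/eqP; rewrite -subr_eq0; apply/eqP/polarization => v.
rewrite mulmxBr mulmx1 mulmxBl mxE [X in _ + X]mxE -qformE -(qY v) qformE.
by rewrite map_mxM trmx_mul !mulmxA subrr.
Qed.

End HermitianForm.

Lemma semilinear_matrix (F : fieldType) n (f : {rmorphism F -> F})
    (p : 'rV[F]_n -> 'rV[F]_n) :
    (forall u v, p (u + v) = p u + p v) ->
    (forall c v, p (c *: v) = f c *: p v) ->
  exists M, forall v, p v = map_mx f v *m M.
Proof.
move=> pD pZ; exists (\matrix_i p (delta_mx 0 i)) => v.
have p0 : p 0 = 0 by apply: (addrI (p 0)); rewrite -pD !addr0.
rewrite {1}[v]row_sum_delta (big_morph _ pD p0) mulmx_sum_row.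
by apply: eq_bigr => i _; rewrite pZ mxE rowK.
Qed.

Lemma exists_frob4_rmorphism (F : finFieldType) k : 2%N \in [pchar F] ->
  exists f : {rmorphism F -> F}, forall x, f x = x ^+ (4 ^ k).
Proof.
move=> F2; elim: k => [|k [f fE]]; first by exists idfun => x; rewrite expr1.
pose fr : {rmorphism F -> F} := pFrobenius_aut F2.
exists (f \o (fr \o fr)) => x /=.
by rewrite fE /fr !pFrobenius_autE -!exprM expnS.
Qed.

(** * The semilinear groups and the base brace *)

Section Factorization.

Variables (K F : finFieldType) (iota : {rmorphism F -> K}) (w : K).
Variables (s : {rmorphism F -> F}) (a : F).
Hypotheses (cardK : #|K| = (2 ^ 18)%N) (cardF : #|F| = 64%N).
Hypotheses (w27 : w ^+ 27 = 1) (w9 : w ^+ 9 != 1).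
Hypotheses (sE : forall x, s x = x ^+ 8) (a_tr : a + s a = 1).

Notation V := 'rV[F]_3.
Notation gT := ({perm V} * 'I_9)%type.
Notation SU := (SU_group 3 s).
Notation toK := (toK iota w).
Notation cg := (@cg F a).

Let toK_inj : injective toK. Proof. exact: toK_inj cardK cardF w27 w9. Qed.

Lemma mxGL_actM g h (v : V) : v *m mxGL (g * h)%g = v *m mxGL g *m mxGL h.
Proof. exact: (mulmxA v (mxGL g) (mxGL h)). Qed.

Lemma mxGL_act_inj g : injective (fun v : V => v *m mxGL g).
Proof.
move=> u v uv; rewrite -[u]mulmx1 -[v]mulmx1 -[1%:M]/(mxGL 1%g) -(mulgV g).
by rewrite !mxGL_actM uv.
Qed.

Definition lin_perm (g : {'GL_3[F]}) : gT := (perm (@mxGL_act_inj g), 0).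

Lemma lin_permE g v : (lin_perm g).1 v = v *m mxGL g.
Proof. exact: permE. Qed.

Lemma lin_permM : {in SU &, {morph lin_perm : g h / (g * h)%g}}.
Proof.
move=> g h _ _; congr (_, _); last exact: (esym (addr0 (0 : 'I_9))).
by apply/permP=> v; rewrite permM !permE mxGL_actM.
Qed.
Canonical lin_perm_morphism := Morphism lin_permM.

Definition linear_part := (lin_perm @* SU)%G.

(* The second component records the exponent [k] of [x |-> t * x ^ 4 ^ k]: *)
(* it is thereby a homomorphism by construction. The group [linear_part]   *)
(* has exponent [0].                                                       *)
Definition semilin_spec (x : gT) (t : K) :=
  forall v, toK (x.1 v) = semiact x.2 t (toK v).

Definition singer :=
  [set x : gT | [exists t in unit_roots K,
    [forall v, toK (x.1 v) == semiact x.2 t (toK v)]]].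

Lemma singerP x :
  reflect (exists2 t, t \in unit_roots K & semilin_spec x t) (x \in singer).
Proof.
rewrite inE; apply: (iffP exists_inP) => -[t Tt xt]; exists t => //.
  by move=> v; apply/eqP/(forallP xt).
by apply/forallP=> v; rewrite xt.
Qed.

Lemma semiact_comp (k l : 'I_9) (t u x : K) :
  semiact l u (semiact k t x) = semiact (k + l)%R (u * frob4 l t) x.
Proof.
by rewrite /semiact frob4M -mulrA frob4_add (frob4_modn cardK) addnC mulrA.
Qed.

Lemma semilin_specM x y (t u : K) : semilin_spec x t -> semilin_spec y u ->
  semilin_spec (x * y)%g (u * frob4 y.2 t).
Proof. by move=> xt yu v; rewrite permM yu xt semiact_comp. Qed.

Lemma singer_group_set : group_set singer.
Proof.
apply/group_setP; split=> [|x y /singerP[t Tt xt] /singerP[u Tu yu]].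
  apply/singerP; exists 1; first by rewrite inE expr1n.
  by move=> v; rewrite perm1 /semiact mul1r frob4.unlock expr1.
apply/singerP; exists (u * frob4 y.2 t); last exact: semilin_specM.
rewrite !inE in Tt Tu *.
by rewrite exprMn (eqP Tu) mul1r frob4.unlock exprAC (eqP Tt) expr1n.
Qed.
Canonical singer_group := Group singer_group_set.

Lemma exists_singer (k : 'I_9) (t : K) : t \in unit_roots K ->
  exists2 x, x \in singer & x.2 = k /\ semilin_spec x t.
Proof.
move=> Tt; have [nz_t _] := unit_root_norm Tt.
have [ofK toKK ofKK] := toK_bij iota cardK cardF w27 w9.
have f_inj : injective (fun v => ofK (semiact k t (toK v))).
  move=> u v /(can_inj ofKK)/(mulfI nz_t) uv; apply: toK_inj.
  have := congr1 (frob4 (9 - k)) uv.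
  by rewrite !frob4_add subnK ?(ltnW (ltn_ord k)) // !(frob4_9 cardK).
have xt : semilin_spec (perm f_inj, k) t by move=> v; rewrite permE ofKK.
by exists (perm f_inj, k) => //; apply/singerP; exists t.
Qed.

Lemma qform_tr v : tr (toK v ^+ (57 * 9)) = iota (qform v).
Proof. exact: tr_norm_toK. Qed.

Lemma iso_toK v : iso (toK v) = (v != 0) && (qform v == 0).
Proof.
rewrite /iso qform_tr fmorph_eq0; congr (~~ _ && _).
have toK0 : toK 0 = 0 by rewrite -(scale0r 0) toKZ rmorph0 mul0r.
by rewrite -{1}toK0 (inj_eq toK_inj).
Qed.

Lemma singer_qform x u v : x \in singer ->
  qform u = qform v -> qform (x.1 u) = qform (x.1 v).
Proof.
case/singerP=> t Tt xt uv; apply: (fmorph_inj iota).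
by rewrite -!qform_tr !xt !(tr_semiact cardK _ _ Tt) !qform_tr uv.
Qed.

Lemma singerD x u v : x \in singer -> x.1 (u + v) = x.1 u + x.1 v.
Proof.
case/singerP=> t Tt xt; apply: toK_inj.
by rewrite toKD !xt toKD /semiact (frob4D cardK) mulrDr.
Qed.

Lemma singerZ x c v : x \in singer -> x.1 (c *: v) = c ^+ (4 ^ x.2) *: x.1 v.
Proof.
case/singerP=> t Tt xt; apply: toK_inj.
rewrite toKZ !xt toKZ /semiact frob4M mulrCA; congr (_ * _).
by rewrite frob4.unlock rmorphXn.
Qed.

(** In a conjugate of a linear map the field automorphisms cancel, so it has a matrix Y. It
    preserves [qform] since x sends vectors of equal [qform] to vectors of equal [qform], and its
    determinant is the image of 1 under a field automorphism. *)
Lemma singer_norm_linear_part : singer \subset 'N(linear_part)%g.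
Proof.
apply/subsetP=> x Ax; rewrite inE.
apply/subsetP=> _ /imsetP[_ /morphimP[g Gg _ ->] ->].
have Ax' : (x^-1)%g \in singer by rewrite groupV.
have [f fE] := exists_frob4_rmorphism x.2 (pchar2 cardF).
have [f' fE'] := exists_frob4_rmorphism (x^-1)%g.2 (pchar2 cardF).
have [M ME] : exists M, forall v, x.1 v = map_mx f v *m M.
  apply: semilinear_matrix => [u v|c v]; first exact: singerD.
  by rewrite singerZ // fE.
have [M' ME'] : exists M, forall v, (x^-1)%g.1 v = map_mx f' v *m M.
  apply: semilinear_matrix => [u v|c v]; first exact: singerD.
  by rewrite singerZ // fE'.
have xV v : x.1 ((x^-1)%g.1 v) = v by exact: (permKV x.1 v).
have ff c : f (f' c) = c.
  have := xV (c *: delta_mx 0 0).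
  rewrite singerZ // -fE' singerZ // -fE xV => /rowP/(_ 0).
  by rewrite !mxE !mulr1.
have xxE h (v : V) :
    x.1 ((x^-1)%g.1 v *m h) = v *m (map_mx f M' *m map_mx f h *m M).
  rewrite ME ME' !map_mxM -map_mx_comp !mulmxA; congr (_ *m _ *m _ *m _).
  by apply/matrixP=> i j; rewrite mxE /= ff.
have M1 : map_mx f M' *m M = 1%:M.
  apply/row_matrixP=> i; rewrite !rowE -{2}(xV (delta_mx 0 i)).
  by rewrite -[(x^-1)%g.1 _]mulmx1 xxE map_mx1 mulmx1 mulmx1.
pose Y := map_mx f M' *m map_mx f (mxGL g) *m M.
have [UY dY] : Y *m (map_mx s Y)^T = 1%:M /\ \det Y = 1.
  split.
    apply: (qform_unitary cardF sE) => v; rewrite -xxE -[in RHS](xV v).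
    by apply: singer_qform => //; apply: (qform_SU sE) Gg.
  have [_ dg] := SUP _ _ Gg.
  by rewrite !det_mulmx mulrAC -det_mulmx M1 det1 mul1r det_map_mx dg rmorph1.
have [g' Gg' g'E] := ex_SU_std UY dY.
suffices -> : (lin_perm g ^ x)%g = lin_perm g' by exact: mem_morphim.
apply/eqP; rewrite xpair_eqE; apply/andP; split; apply/eqP.
  apply/permP=> v; rewrite [RHS]lin_permE g'E -xxE /= !permM.
  by rewrite -lin_permE.
by change ((- x.2 + (0 + x.2))%R = 0 :> 'I_9); rewrite add0r addNr.
Qed.

(** All scalars of F_64, not only the unitary ones: they lie in [singer], so the quotient preserves
    its trivial intersection with [point_stab], and they meet [linear_part] in the image of the
    centre of SU. *)
Definition scalars :=
  [set x : gT | (x.2 == 0) &&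
    [exists c : F, (c != 0) && [forall v, x.1 v == c *: v]]].

Lemma scalarsP (x : gT) :
  reflect (x.2 = 0 /\ exists2 c, c != 0 & forall v, x.1 v = c *: v)
    (x \in scalars).
Proof.
rewrite inE; apply: (iffP andP) => -[/eqP x2].
  case/existsP=> c /andP[nzc /forallP xc]; split=> //.
  by exists c => // v; apply/eqP.
case=> c nzc xc; split=> //; apply/existsP; exists c; rewrite nzc.
by apply/forallP=> v; rewrite xc.
Qed.

Lemma scalars_group_set : group_set scalars.
Proof.
apply/group_setP; split=> [|x y].
  apply/scalarsP; split=> //; exists 1; first exact: oner_neq0.
  by move=> v; rewrite perm1 scale1r.
case/scalarsP=> x2 [c nzc xc] /scalarsP[y2 [d nzd yd]].
apply/scalarsP; split; first by rewrite /= x2 y2; apply: addr0.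
exists (d * c); first by rewrite mulf_neq0.
by move=> v; rewrite permM xc yd scalerA.
Qed.
Canonical scalars_group := Group scalars_group_set.

Lemma scalars_sub_singer : scalars \subset singer.
Proof.
apply/subsetP=> x /scalarsP[x2 [c nzc xc]]; apply/singerP; exists (iota c).
  rewrite inE -rmorphXn mulnC exprM -[63%N]/(64.-1) -cardF expf_card1 //.
  by rewrite expr1n rmorph1.
by move=> v; rewrite xc x2 toKZ /semiact frob4.unlock expr1.
Qed.

Lemma singer_norm_scalars : singer \subset 'N(scalars)%g.
Proof.
apply/subsetP=> x Ax; rewrite inE.
apply/subsetP=> _ /imsetP[z /scalarsP[z2 [c nzc zc]] ->].
apply/scalarsP; split.
  by change ((- x.2 + (z.2 + x.2))%R = 0 :> 'I_9); rewrite z2 add0r addNr.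
exists (c ^+ (4 ^ x.2)); first by rewrite expf_neq0.
by move=> v; rewrite /= !permM zc singerZ // permKV.
Qed.

Lemma linear_part_norm_scalars : linear_part \subset 'N(scalars)%g.
Proof.
apply: subset_trans (cent_sub _); apply/subsetP=> _ /morphimP[g _ _ ->].
apply/centP=> z /scalarsP[z2 [c nzc zc]]; apply/eqP.
rewrite xpair_eqE; apply/andP; split; apply/eqP; last exact: addrC.
by apply/permP=> v; rewrite !permM zc !lin_permE zc scalemxAl.
Qed.

Definition full_group := (linear_part <*> singer)%G.

Lemma full_groupE : full_group = (linear_part * singer)%g :> {set gT}.
Proof. by apply: norm_joinEr; apply: singer_norm_linear_part. Qed.

Lemma linear_part_normal : (linear_part <| full_group)%g.
Proof.
by rewrite /normal joing_subl join_subG normG singer_norm_linear_part.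
Qed.

Lemma full_norm_scalars : full_group \subset 'N(scalars)%g.
Proof. by rewrite join_subG linear_part_norm_scalars singer_norm_scalars. Qed.

Definition base_vec : V := eJ F *m Smx a.

Definition point_stab := [set x in full_group | x.1 base_vec == base_vec].

Lemma point_stabP (x : gT) :
  reflect (x \in full_group /\ x.1 base_vec = base_vec) (x \in point_stab).
Proof. by apply: (iffP setIdP) => -[Gx /eqP]. Qed.

Lemma point_stab_group_set : group_set point_stab.
Proof.
apply/group_setP; split=> [|x y /point_stabP[Gx xe] /point_stabP[Gy ye]].
  by apply/point_stabP; rewrite group1 perm1.
by apply/point_stabP; rewrite groupM // permM xe ye.
Qed.
Canonical point_stab_group := Group point_stab_group_set.

Lemma iso_base : iso (toK base_vec).
Proof.
rewrite iso_toK (qform_hJ cardF sE a_tr) hJ_e eqxx andbT.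
apply/eqP=> e0; have := eJ_neq0 F.
rewrite -(mulmxK (Smx_unit cardF a_tr) (eJ F)).
by rewrite -/base_vec e0 mul0mx eqxx.
Qed.

Lemma lin_perm_iso (n : gT) : n \in linear_part -> iso (toK (n.1 base_vec)).
Proof.
case/morphimP=> g _ Gg ->; rewrite lin_permE.
have := iso_base; rewrite !iso_toK (qform_SU sE _ Gg) => /andP[nz_e ->].
rewrite andbT; apply: contra nz_e => /eqP e0; apply/eqP.
by apply: (@mxGL_act_inj g); rewrite /= e0 mul0mx.
Qed.

(** Some x in [singer] agrees with n^-1 at the base vector, by transitivity; then n = x^-1 (x n),
    and x n fixes that vector. *)
Lemma linear_part_sub_factor : linear_part \subset (singer * point_stab)%g.
Proof.
apply/subsetP=> n Nn; have Nn' : (n^-1)%g \in linear_part by rewrite groupV.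
have [k [t [Tt nkt]]] := semiact_trans cardK iso_base (lin_perm_iso Nn').
have [x Ax [xk xt]] := exists_singer k Tt.
have xe : x.1 base_vec = (n^-1)%g.1 base_vec.
  by apply: toK_inj; rewrite xt xk nkt.
apply/imset2P; exists (x^-1)%g (x * n)%g; rewrite ?groupV ?mulKg //.
apply/point_stabP; split.
  by rewrite groupM // mem_gen // inE ?Ax ?Nn ?orbT.
by rewrite permM xe; apply: (permKV n.1).
Qed.

Lemma singer_point_stab_TI : (singer :&: point_stab = 1)%g.
Proof.
apply/trivgP/subsetP=> x /setIP[/singerP[t Tt xt] /point_stabP[_ xe]].
have T1 : 1 \in unit_roots K by rewrite inE expr1n.
have := xt base_vec; rewrite xe => e_fix.
have e1 : semiact 0%N 1 (toK base_vec) = toK base_vec.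
  by rewrite /semiact mul1r frob4.unlock expr1.
have [k0 t1] : x.2 = 0 /\ t = 1.
  by apply: (semiact_inj cardK iso_base Tt T1); rewrite -e_fix e1.
rewrite inE; apply/eqP; rewrite [x]surjective_pairing k0; congr (_, _).
apply/permP=> v; rewrite perm1; apply: toK_inj.
by rewrite xt k0 t1 /semiact mul1r frob4.unlock expr1.
Qed.

Lemma singer_sol : solvable singer.
Proof.
have sM : {in singer &, {morph (fun x : gT => x.2) : x y / (x * y)%g}} by [].
apply: (@solvable_ker_im _ _ _ (Morphism sM)); last first.
  by apply/abelian_sol/centsP=> x _ y _; apply: addrC.
apply/abelian_sol/centsP=> x kx y ky.
have x2 : x.2 = 0 := mker kx; have y2 : y.2 = 0 := mker ky.
have /singerP[t _ xt] := dom_ker kx; have /singerP[u _ yu] := dom_ker ky.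
apply/eqP; rewrite xpair_eqE; apply/andP; split; apply/eqP; last exact: addrC.
apply/permP=> v; apply: toK_inj; rewrite !permM !xt !yu !xt x2 y2.
by rewrite /semiact frob4.unlock !expr1 mulrCA.
Qed.

(** Modulo [linear_part] it embeds in a quotient of [singer], and its intersection with
    [linear_part] lies in the image of the 2-group [vec_stab]. *)
Lemma point_stab_sol : solvable point_stab.
Proof.
have solQ : solvable (full_group / linear_part).
  have -> : (full_group / linear_part = singer / linear_part)%g.
    by rewrite full_groupE quotientMidl.
  exact: quotient_sol singer_sol.
have sPG : point_stab \subset full_group by apply/subsetP=> x /point_stabP[].
apply: (solvable_quotient_normal linear_part_normal sPG solQ).
have sU : linear_part :&: point_stab \subset (lin_perm @* vec_stab s a)%g.
  apply/subsetP=> _ /setIP[/morphimP[g Gg _ ->] /point_stabP[_]].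
  rewrite lin_permE /base_vec -mulmxA (cgE cardF a_tr) mulmxA.
  move/(can_inj (mulmxK (Smx_unit cardF a_tr))) => ge.
  by apply: mem_morphim => //; apply/vec_stabP.
exact: solvableS sU (morphim_sol _ (pgroup_sol (vec_stab_2group cardF a_tr))).
Qed.

Notation Q := (coset_of scalars).
Notation Nbar := (linear_part / scalars)%G.
Notation Abar := (singer / scalars)%G.
Notation Pbar := (point_stab / scalars)%G.

Lemma point_stab_sub : point_stab \subset full_group.
Proof. by apply/subsetP=> x /point_stabP[]. Qed.

Lemma Abar_norm : Abar \subset 'N(Nbar)%g.
Proof. exact: quotient_norms singer_norm_linear_part. Qed.

Lemma Pbar_norm : Pbar \subset 'N(Nbar)%g.
Proof.
apply: quotient_norms; apply: subset_trans point_stab_sub _.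
exact: normal_norm linear_part_normal.
Qed.

Lemma Abar_Pbar_TI : (Abar :&: Pbar = 1)%g.
Proof.
rewrite /= -quotientGI ?scalars_sub_singer // singer_point_stab_TI.
exact: quotient1.
Qed.

Lemma Nbar_sub_factor : Nbar \subset (Abar * Pbar)%g.
Proof.
rewrite /= -quotientMl ?singer_norm_scalars //.
exact: quotientS linear_part_sub_factor.
Qed.

Lemma mxGL_scalar_center g : g \in SU ->
  (lin_perm g \in scalars) = (g \in 'Z(SU)%g).
Proof.
move=> Gg; have uS := Smx_unit cardF a_tr.
apply/scalarsP/idP => [[_ [c nzc gc]] | Zg].
  have gE : mxGL g = c%:M.
    by apply/row_matrixP=> i; rewrite !rowE -lin_permE gc mul_mx_scalar.
  apply: (scalar_center cardF a_tr Gg (c := c)).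
  by rewrite cg.unlock gE mul_mx_scalar -scalemxAl mulmxV // scalemx1.
have [c gc] := SU_center cardF sE a_tr Zg.
have gE : mxGL g = c%:M.
  apply: (can_inj (mulKmx uS)); rewrite (cgE cardF a_tr) gc.
  by rewrite scalar_mxC.
split=> //; exists c; last by move=> v; rewrite lin_permE gE mul_mx_scalar.
apply: contraTneq isT => c0; have [_] := SUP _ _ Gg.
by rewrite gE c0 det_scalar expr0n /= => /eqP; rewrite eq_sym oner_eq0.
Qed.

Lemma coset_linM :
  {in SU &, {morph (fun g => coset scalars (lin_perm g)) : g h / (g * h)%g}}.
Proof.
have nZ g : g \in SU -> lin_perm g \in 'N(scalars)%g.
  by move=> Gg; apply: (subsetP linear_part_norm_scalars); apply: mem_morphim.
by move=> g h Gg Gh; rewrite /= lin_permM // morphM ?nZ.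
Qed.

Lemma PSU_isog : (SU / 'Z(SU) \isog Nbar)%g.
Proof.
pose f := Morphism coset_linM.
have nZ g : g \in SU -> lin_perm g \in 'N(scalars)%g.
  by move=> Gg; apply: (subsetP linear_part_norm_scalars); apply: mem_morphim.
have kerf : ('ker f = 'Z(SU))%g.
  apply/setP=> g; apply/idP/idP => [kg | Zg].
    have Gg : g \in SU := dom_ker kg.
    by rewrite -mxGL_scalar_center // coset_idr ?nZ //; apply: mker kg.
  have Gg : g \in SU := subsetP (center_sub _) g Zg.
  by apply/kerP => //; apply: coset_id; rewrite mxGL_scalar_center.
have imf : (f @* SU = Nbar)%g.
  apply/eqP; rewrite eqEsubset; apply/andP; split; apply/subsetP=> y.
    by case/morphimP=> g _ Gg ->; apply/mem_quotient/mem_morphim.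
  case/morphimP=> x _ /morphimP[g _ Gg ->] ->.
  exact: (mem_morphim f).
by rewrite -imf -kerf first_isog.
Qed.

Definition deg3 (k : 'I_9) : 'I_3 := inZp k.

Lemma deg3D k l : deg3 (k + l) = deg3 k + deg3 l.
Proof. by apply: val_inj; rewrite /= modn_dvdm // modnDm. Qed.

Definition exponent (y : Q) : 'I_3 := deg3 (repr y).2.

Lemma exponent_coset x :
  x \in 'N(scalars)%g -> exponent (coset scalars x) = deg3 x.2.
Proof.
move=> nx; have := coset_reprK (coset scalars x).
move/(kercoset_rcoset (repr_coset_norm _) nx) => [z /scalarsP[z2 _] zx].
by rewrite /exponent zx; congr deg3; rewrite -[RHS]add0r -z2.
Qed.

Lemma exponentM (y z : Q) : exponent (y * z)%g = exponent y + exponent z.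
Proof.
rewrite -[y in LHS]coset_reprK -[z in LHS]coset_reprK.
rewrite -morphM ?repr_coset_norm //.
by rewrite exponent_coset ?groupM ?repr_coset_norm // -deg3D.
Qed.

Definition base_brace : finSkewBrace :=
  factorization_brace Abar_norm Pbar_norm Abar_Pbar_TI Nbar_sub_factor.

Definition base_chi (x : base_brace) : 'I_3 :=
  exponent (remgr Abar Pbar (sgval x)).

Lemma base_chiM (x y : base_brace) :
  base_chi (circ x y) = base_chi x + base_chi y.
Proof.
rewrite [RHS]addrC -exponentM /base_chi -(remgr_fcirc Pbar_norm) //.
- exact: Abar_Pbar_TI.
exact: Nbar_sub_factor.
Qed.

(** Let x be the Frobenius map v |-> v^4 of K, and g in SU agree with x at the base vector. Then p =
    x g^-1 is in [point_stab] with exponent 1, and it is the second factor of g^-1 = x^-1 p. *)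
Lemma base_chi_nt : exists x : base_brace, base_chi x != 0.
Proof.
have T1 : 1 \in unit_roots K by rewrite inE expr1n.
have [x Ax [xk xt]] := exists_singer (1 : 'I_9) T1.
have := iso_semiact cardK x.2 T1 iso_base; rewrite -xt iso_toK.
set v := x.1 base_vec => /andP[nz_v /eqP qv].
have uS := Smx_unit cardF a_tr.
pose u := v *m invmx (Smx a); have vE : u *m Smx a = v by rewrite mulmxKV.
have nz_u : u != 0 by apply: contraNneq nz_v => u0; rewrite -vE u0 mul0mx.
have hu : hJ s u u = 0 by rewrite -(qform_hJ cardF sE a_tr) vE.
have [g Gg ge] := SU_trans cardF sE a_tr nz_u hu.
have gv : (lin_perm g).1 base_vec = v.
  by rewrite lin_permE /base_vec -mulmxA (cgE cardF a_tr) mulmxA ge.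
have Ng : lin_perm g \in linear_part by apply: mem_morphim.
pose p := (x * (lin_perm g)^-1)%g.
have Pp : p \in point_stab.
  apply/point_stabP; split.
    by rewrite groupM ?groupV // mem_gen // inE ?Ax ?Ng ?orbT.
  rewrite permM -/v; apply: (canLR (permK (lin_perm g).1)).
  exact: esym gv.
have np : p \in 'N(scalars)%g.
  exact: (subsetP full_norm_scalars) (subsetP point_stab_sub _ Pp).
have nx : x \in 'N(scalars)%g by apply: (subsetP singer_norm_scalars).
exists (subg Nbar (coset scalars (lin_perm g)^-1)%g).
rewrite /base_chi subgK; last by rewrite mem_quotient ?groupV.
have -> : ((lin_perm g)^-1 = x^-1 * p)%g by rewrite mulKg.
rewrite morphM ?groupV // (remgrMid Abar_Pbar_TI) ?mem_quotient ?groupV //.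
rewrite exponent_coset //.
have -> : p.2 = 1.
  by change (x.2 + - 0 = 1 :> 'I_9); rewrite xk subr0.
by [].
Qed.

Lemma base_solvable : solvable [set: circ_group base_brace].
Proof.
apply: solvable_factorization_brace; apply: quotient_sol.
  exact: singer_sol.
exact: point_stab_sol.
Qed.

End Factorization.

Lemma simple_lambda_simple (B : finSkewBrace) :
  simple [set: B]%g -> lambda_simple B.
Proof.
by case/simpleP=> _ simB I nI _; have [->|->] := simB I nI; [left | right].
Qed.

Section ProjectiveSpecialUnitary.

Variables (F : finFieldType) (s : {rmorphism F -> F}) (a : F).
Hypotheses (cardF : #|F| = 64%N) (sE : forall x, s x = x ^+ 8).
Hypothesis (a_tr : a + s a = 1).

Lemma PSU_simple : simple (PSU 3 s).
Proof.
apply/simpleP; split=> [|K nK].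
  rewrite -subG1 quotient_sub1 ?normal_norm ?center_normal //.
  exact: (SU_noncentral cardF sE a_tr).
have [L -> sZL nLG] := inv_quotientN (center_normal _) nK.
have [sLZ | LG] := SU_normal cardF sE a_tr nLG; [left | right].
  apply/trivgP; rewrite quotient_sub1 // (subset_trans (normal_sub nLG)) //.
  exact: normal_norm (center_normal _).
by rewrite LG.
Qed.

Lemma PSU_nonabelian : ~~ abelian (PSU 3 s).
Proof.
apply/negP=> /derG1P; rewrite -quotient_der ?normal_norm ?center_normal //.
rewrite (SU_perfect cardF sE a_tr); have /simpleP[/eqP nt _] := PSU_simple.
exact: nt.
Qed.

End ProjectiveSpecialUnitary.

Lemma frob8E x : frob8 x = x ^+ 8. Proof. by []. Qed.

Lemma exists_prim_root63 : exists g : F64, 63.-primitive_root g.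
Proof. by have [g] := finField_prim_root F64; rewrite card_F64; exists g. Qed.

Lemma exists_trace1 : exists a : F64, a + frob8 a = 1.
Proof.
(* A primitive cube root of unity: a^8 = a^2, and a + a^2 = -1 = 1. *)
have [g gP] := exists_prim_root63; pose a := g ^+ 21; exists a.
have a3 : a ^+ 3 = 1 by rewrite -exprM (prim_expr_order gP).
have a1 : a != 1 by rewrite -(prim_order_dvd gP).
have sum0 : 1 + a + a ^+ 2 = 0.
  apply: (mulfI (_ : a - 1 != 0)); first by rewrite subr_eq0.
  rewrite mulr0; have := subrX1 a 3.
  by rewrite a3 subrr !big_ord_recr big_ord0 /= add0r expr0 expr1 => <-.
rewrite frob8E (exprD a 6 2) (exprM a 3 2) a3 expr1n mul1r.
apply/eqP; rewrite -subr_eq0 (oppr_pchar2 pchar_F64) addrC addrA.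
by rewrite sum0.
Qed.

Lemma exists_order9 : exists z : F64, z ^+ 9 = 1 /\ z ^+ 3 != 1.
Proof.
have [g gP] := exists_prim_root63; exists (g ^+ 7).
by rewrite -!exprM (prim_expr_order gP) -(prim_order_dvd gP).
Qed.

Local Open Scope group_scope.

Theorem corollaryF :
  forall m : nat, exists B : finSkewBrace,
    [/\ simple_skew_brace B,
        ([set: B] \isog direct_power PSU_3_8 (3 ^ m))%g
      & solvable [set: circ_group B]].
Proof.
have sE := frob8E; have [a a_tr] := exists_trace1.
have [z [z9 z3]] := exists_order9.
have [K [iota [w [cardK wz]]]] := exists_cubic_kummer_ext card_F64 z9 z3.
have w27 : (w ^+ 27 = 1)%R by rewrite (exprM w 3 9) wz -rmorphXn z9 rmorph1.
have w9 : (w ^+ 9 != 1)%R by rewrite (exprM w 3 3) wz -rmorphXn fmorph_eq1.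
pose B := base_brace iota cardK card_F64 w27 w9 sE a_tr.
have isoB : [set: B] \isog PSU_3_8.
  rewrite isog_sym; apply: isog_trans (PSU_isog card_F64 sE a_tr) _.
  exact: isog_subg.
have simB : simple [set: B].
  by rewrite (isog_simple isoB) (PSU_simple card_F64 sE a_tr).
have ZB : 'Z([set: B]) = 1.
  have [_ /(_ 'Z([set: B])%G (center_normal _))[]//] := simpleP _ simB.
  move=> ZT; case/negP: (PSU_nonabelian card_F64 sE a_tr).
  rewrite -(isog_abelian isoB); apply/center_idP; exact: ZT.
have [f injf fB] := isogP isoB.
pose f0 (x : B) (_ : unit) := f x.
have fr : power_repr [group of PSU_3_8] f0.
  split.
  - by move=> x y j; rewrite /f0 morphM ?inE.
  - by move=> x y /(_ tt); apply: (injmP injf); rewrite inE.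
  - move=> x j; have : f x \in f @* [set: B] by rewrite mem_morphim ?inE.
    by rewrite fB.
  move=> g Gg; have : g tt \in f @* [set: B] by rewrite fB; apply: Gg.
  by case/morphimP=> x _ _ gx; exists x => -[].
apply: (simple_brace_powers _ _ ZB (simple_lambda_simple simB) _ fr).
- exact: base_chiM.
- exact: base_chi_nt.
exact: base_solvable.
Qed.
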